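(* Let $\Omega$ be a set and let $G = \operatorname{Sym}(\Omega)$ be the symmetric group on $\Omega$. Let $k \geq 2$, let $H_1,\ldots,H_k$ be proper subgroups of $G$ and let $x_1,\ldots,x_k \in G$ be such that $G = \bigcup_{i=1}^k H_i x_i$ and $H_i x_i \cap H_j x_j = \emptyset$ for all $i \neq j$. Then $[G:H_i] = [G:H_j]$ for some $i \neq j$. (That is, the Herzog-Schönheim Conjecture is true for symmetric groups.)
   Context: $\operatorname{Sym}(\Omega)$ is the group of all permutations of $\Omega$; $\Omega$ may be finite or infinite. $[G:H]$ denotes the index of $H$ in $G$. The Herzog-Schönheim Conjecture for a group $G$ is the statement: if $H_1,\ldots,H_k$ ($k \geq 2$) are proper subgroups of $G$ and $x_1,\ldots,x_k \in G$ are such that $G$ is the disjoint union of the cosets $H_1x_1,\ldots,H_kx_k$, then $[G:H_i]=[G:H_j]$ for some $i \neq j$. *)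

(* Defs.v *)
From HB Require Import structures.
From mathcomp Require Import all_boot.
From mathcomp Require Import boolp classical_sets functions cardinality.

Set Implicit Arguments.
Unset Strict Implicit.
Unset Printing Implicit Defensive.

Local Open Scope classical_set_scope.
Local Open Scope card_scope.

Record Sym (Omega : Type) := MkSym {
  sym_fun :> Omega -> Omega;
  sym_bij : bijective sym_fun
}.

Section SymGroup.
Variable Omega : Type.
Implicit Types s t u : Sym Omega.

Lemma symP s t : s =1 t -> s = t.
Proof.
case: s t => [f fP] [g gP] /= /funext fg.
by case: _ / fg gP => gP; rewrite (Prop_irrelevance fP gP).
Qed.

Definition sym_one : Sym Omega :=
  MkSym (Bijective (fun=> erefl) (fun=> erefl) : bijective id).

(* As for [{perm T}], permutations act on the right: s * t is s followed by t. *)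
Definition sym_mul s t : Sym Omega := MkSym (bij_comp (sym_bij t) (sym_bij s)).

Lemma sym_inv_subproof s : {g | cancel s g & cancel g s}.
Proof. by apply/cid2; case: (sym_bij s) => g sK gK; exists g. Qed.

Definition sym_inv s : Sym Omega :=
  let: exist2 g sK gK := sym_inv_subproof s in MkSym (Bijective gK sK).

Lemma sym_invK s : cancel s (sym_inv s).
Proof. by rewrite /sym_inv; case: sym_inv_subproof. Qed.

Lemma sym_invKV s : cancel (sym_inv s) s.
Proof. by rewrite /sym_inv; case: sym_inv_subproof. Qed.

Lemma sym_mulA : associative sym_mul.
Proof. by move=> s t u; apply: symP. Qed.

Lemma sym_mul1 : left_id sym_one sym_mul.
Proof. by move=> s; apply: symP. Qed.

Lemma sym_mul1r : right_id sym_one sym_mul.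
Proof. by move=> s; apply: symP. Qed.

Lemma sym_mulV : left_inverse sym_one sym_inv sym_mul.
Proof. by move=> s; apply: symP => a /=; rewrite sym_invKV. Qed.

Lemma sym_mulrV : right_inverse sym_one sym_inv sym_mul.
Proof. by move=> s; apply: symP => a /=; rewrite sym_invK. Qed.

HB.instance Definition _ := gen_eqMixin (Sym Omega).
HB.instance Definition _ := gen_choiceMixin (Sym Omega).
HB.instance Definition _ := isGroup.Build (Sym Omega)
  sym_mulA sym_mul1 sym_mul1r sym_mulV sym_mulrV.

Lemma symM s t a : (s * t)%g a = t (s a). Proof. by []. Qed.
Lemma sym1 a : (1%g : Sym Omega) a = a. Proof. by []. Qed.

End SymGroup.

Section Cosets.
Variable G : groupType.
Implicit Type H : set G.

Definition is_subgroup H : Prop := group_closed [in H].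

Definition right_coset H (x : G) : set G := [set (h * x)%g | h in H].

Definition right_cosets H : set (set G) := range (right_coset H).

(* [G : H] = [G : K] as an equality of (possibly infinite) cardinals. *)
Definition eq_index H K : Prop := right_cosets H #= right_cosets K.

End Cosets.

(* Main.v *)
Require Import Defs.
From HB Require Import structures.
From Stdlib Require Import NArith.
From mathcomp Require Import all_boot all_order all_algebra all_fingroup all_solvable.
From mathcomp Require Import zify ring lra.

(** The infinite and the finite case are unrelated.

For infinite Omega the group Sym(Omega) has no covering at all by finitely many
cosets of proper subgroups.  By B. H. Neumann's lemma ([neumann_finite_index])
one of the subgroups, H, would have finite index, so by the pigeonhole principle
H would contain every m-th power for some m > 0 ([finite_index_exponent]).
Now m-th powers generate Sym(Omega).  A transposition is a product of two
involutions which flip all pairs of a sequence of disjoint pairs, with and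
without the first pair, and both of these are m-th powers, because m consecutive
pairs can be merged into one cycle of length 2m ([transp_mem]).  For an
arbitrary involution, Zorn's lemma merges as many pairs as possible in groups of
m, and fewer than m pairs remain ([involution_mem]).  Finally each permutation
is a product of two involutions, by reflecting each of its orbits
([sym_two_involutions]).  So H is everything ([finite_index_Sym_infinite]).

For finite Omega, with n points, suppose that the indices of the subgroups are
pairwise distinct.  If one of the subgroups is Alt(n), then the other cosets
partition the second coset of Alt(n), and after a translation they are cosets of
proper subgroups of Alt(n).  So in all cases K, which is Sym(n) or Alt(n), is
partitioned into cosets of subgroups H that do not contain Alt(n), with distinct
indices d = [K : H] whose reciprocals add up to 1; moreover no two of these
indices are coprime, since cosets of subgroups of coprime indices always meet.
The contradiction is that the reciprocals of such indices add up to less than 1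
([sum_inv_admissible_lt1]).  This uses strong restrictions on d besides the
divisibility of n! by d, collected in [admissible]:

- If H contains a 3-cycle, take a maximal set M of points, of size a at least 3,
  such that H contains Alt(M).  Two such sets which meet have a union of the
  same kind, so the images of M under H are disjoint, and their number b is at
  most n / a.  As K is transitive on the a-sets, C(n, a) divides d b
  ([index_of_alt_full]).  Hence d is a multiple of a number of size at least
  C(n, a) / b.

- If H contains no 3-cycle, then 3 divides d, because H contains no Sylow
  3-subgroup of K ([dvd3_index_no3]), and d is huge: 2 d is at least the factorial
  of n/2, rounded up, by Bochert's argument on bases
  ([uphalf_fact_le_index_no3]).  For n at least 5 also d is at least n, as Alt(n) is
  simple ([deg_le_index_no3]).

For n at least 17 the sum of the reciprocals of the divisors of n! is at most n/3
and the number of divisors of n! is at most a sixteenth of the factorial of n/2,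
rounded up.  So the indices of the first kind contribute at most 5/6 and those of
the second kind at most 1/8.  For n at most 16 the sum over all admissible
divisors of n! is computed; it is below 1 except for n = 4 and n = 8, where the fact that no two
indices are coprime finishes the proof. *)

Set Implicit Arguments.
Unset Strict Implicit.
Unset Printing Implicit Defensive.

(** * Indices of subgroups of finite symmetric and alternating groups *)

Section SubgroupIndices.
Import GroupScope.

Ltac by_neq := first [done | by rewrite eq_sym].

Section ThreeCycles.
Variable T : finType.
Implicit Types (x y z c : T) (s : {perm T}) (A B : {set T}).

Definition cyc3 x y z : {perm T} := tperm x y * tperm x z.

Lemma cyc3J x y z s : cyc3 x y z ^ s = cyc3 (s x) (s y) (s z).
Proof. by rewrite conjMg !tpermJ. Qed.

Lemma cyc3V x y z : (cyc3 x y z)^-1 = cyc3 x z y.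
Proof. by rewrite invMg !tpermV. Qed.

Lemma cyc3_rot x y z : x != y -> y != z -> cyc3 x y z = cyc3 z x y.
Proof.
move=> xy yz; rewrite /cyc3 conjgC tpermJ tpermL tpermD //.
- by rewrite (tpermC z x).
- by rewrite eq_sym.
Qed.

(** Membership of all 3-cycles can thus be checked on those through one point. *)
Lemma cyc3_base c x y z : c != y -> c != z -> x != y -> x != z ->
  cyc3 x y z = cyc3 c x y * cyc3 c z x.
Proof.
move=> cy cz xy xz; rewrite /cyc3 -!mulgA (mulgA (tperm c y)).
rewrite -{1}(tpermV c x) -conjgE conjMg !tpermJ tpermL.
by rewrite !tpermD.
Qed.

Lemma cyc3_1 x y z : x != y -> y != z -> cyc3 x y z x = y.
Proof. by move=> xy yz; rewrite permM tpermL tpermD; by_neq. Qed.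

Lemma cyc3_2 x y z : cyc3 x y z y = z.
Proof. by rewrite permM tpermR tpermL. Qed.

Lemma cyc3_3 x y z : x != z -> y != z -> cyc3 x y z z = x.
Proof. by move=> xz yz; rewrite permM (tpermD xz yz) tpermR. Qed.

Lemma cyc3_fix x y z t : x != t -> y != t -> z != t -> cyc3 x y z t = t.
Proof. by move=> xt yt zt; rewrite permM (tpermD xt yt) (tpermD xt zt). Qed.

(** For a set [A] of at least three points: [H] contains the alternating group on
    [A].  The formulation by 3-cycles is convenient when two such sets are merged. *)
Definition alt_full (H : {set {perm T}}) A :=
  [forall x in A, forall y in A, forall z in A,
     [&& x != y, y != z & x != z] ==> (cyc3 x y z \in H)].

Lemma alt_fullP (H : {set {perm T}}) A :
  reflect (forall x y z, x \in A -> y \in A -> z \in A ->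
            x != y -> y != z -> x != z -> cyc3 x y z \in H)
          (alt_full H A).
Proof.
apply: (iffP idP) => [fA x y z xA yA zA xy yz xz|fA].
  move/forall_inP: fA => /(_ x xA)/forall_inP/(_ y yA)/forall_inP/(_ z zA).
  by rewrite xy yz xz.
apply/forall_inP => x xA; apply/forall_inP => y yA; apply/forall_inP => z zA.
by apply/implyP => /and3P[xy yz xz]; apply: fA.
Qed.

Variable H : {group {perm T}}.

Lemma alt_full_base A c : c \in A ->
  (forall x y, x \in A -> y \in A -> c != x -> c != y -> x != y ->
     cyc3 c x y \in H) -> alt_full H A.
Proof.
move=> cA fc; apply/alt_fullP => x y z xA yA zA xy yz xz.
have [cx|cx] := eqVneq c x; first by subst c; apply: fc.
have [cy|cy] := eqVneq c y.
  subst c; rewrite cyc3_rot // cyc3_rot //; last by rewrite eq_sym.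
  by apply: fc => //; rewrite eq_sym.
have [cz|cz] := eqVneq c z.
  by subst c; rewrite cyc3_rot //; apply: fc => //; rewrite eq_sym.
by rewrite (@cyc3_base c) // groupM // fc // eq_sym.
Qed.

Lemma third_point A x y : 3 <= #|A| -> exists2 u, u \in A & (u != x) && (u != y).
Proof.
move=> A3; have /subsetPn[u uA] : ~~ (A \subset [set x; y]).
  apply: contraL A3 => /subset_leq_card le; rewrite -ltnNge ltnS.
  by apply: leq_trans le _; rewrite cards2; case: (_ != _).
by rewrite !inE negb_or => uxy; exists u.
Qed.

(** By the reduction to 3-cycles through the common point [c], only the cycles
    through [c], a point [x] of [A] and a point [y] of [B] are needed.  They are
    obtained by conjugating a 3-cycle [(c x u)] of [A] by 3-cycles that move [c]
    to [y] and then [u] or [x] to [c]. *)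
Lemma alt_full_union A B c : 3 <= #|A| -> 3 <= #|B| -> c \in A -> c \in B ->
  alt_full H A -> alt_full H B -> alt_full H (A :|: B).
Proof.
move=> A3 B3 cA cB /alt_fullP fA /alt_fullP fB.
have key x y : x \in A -> y \in B -> c != x -> c != y -> x != y ->
    cyc3 c x y \in H.
  move=> xA yB cx cy xy.
  have [xB|xNB] := boolP (x \in B); first exact: fB.
  have [yA|yNA] := boolP (y \in A); first exact: fA.
  have [u uA /andP[uc ux]] := third_point c x A3.
  have [v vB /andP[vc vy]] := third_point c y B3.
  have uy : u != y by apply: contraNneq yNA => <-.
  have vx : v != x by apply: contraNneq xNB => <-.
  have cuxH : cyc3 c u x \in H by apply: fA => //; rewrite eq_sym.
  have cyvH : cyc3 c y v \in H by apply: fB => //; rewrite eq_sym.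
  have cxuH : cyc3 c x u \in H by apply: fA => //; rewrite eq_sym.
  (* The two third points may coincide; then one conjugation is enough. *)
  have [uv|uv] := eqVneq u v.
    subst v.
    have := groupJ cxuH cyvH; rewrite cyc3J.
    have -> : cyc3 c y u c = y by rewrite cyc3_1; by_neq.
    have -> : cyc3 c y u x = x by rewrite cyc3_fix; by_neq.
    have -> : cyc3 c y u u = c by rewrite cyc3_3; by_neq.
    by move=> yxc; rewrite -groupV cyc3V (@cyc3_rot c y x) ?(@cyc3_rot x c y); by_neq.
  have := groupJ (groupJ cxuH cyvH) cuxH; rewrite !cyc3J.
  have -> : cyc3 c y v c = y by rewrite cyc3_1; by_neq.
  have -> : cyc3 c y v x = x by rewrite cyc3_fix; by_neq.
  have -> : cyc3 c y v u = u by rewrite cyc3_fix; by_neq.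
  have -> : cyc3 c u x y = y by rewrite cyc3_fix; by_neq.
  have -> : cyc3 c u x x = c by rewrite cyc3_3; by_neq.
  have -> : cyc3 c u x u = x by rewrite cyc3_2; by_neq.
  by rewrite (@cyc3_rot y c x) ?(@cyc3_rot x y c); by_neq.
apply: (@alt_full_base _ c); first by rewrite inE cA.
move=> x y; rewrite !inE => /orP[xA|xB] /orP[yA|yB] cx cy xy.
- exact: fA.
- exact: key.
- by rewrite -groupV cyc3V key; by_neq.
- exact: fB.
Qed.

Lemma alt_fullJ A s : s \in H -> alt_full H A -> alt_full H (s @: A).
Proof.
move=> sH /alt_fullP fA; apply/alt_fullP => _ _ _
  /imsetP[x xA ->] /imsetP[y yA ->] /imsetP[z zA ->].
rewrite !(inj_eq perm_inj) => xy yz xz.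
by rewrite -cyc3J groupJr ?fA.
Qed.

(** An even permutation is a product of pairs of transpositions, and
    [(a b)(c d) = (a b)(a c) (a c)(c d)] is a product of two 3-cycles, some of
    which may degenerate to the identity. *)
Lemma alt_full_setT : alt_full H setT -> 'Alt_T \subset H.
Proof.
move/alt_fullP => fH.
have pair1 a b c : a != b -> a != c -> tperm a b * tperm a c \in H.
  move=> ab ac; have [->|bc] := eqVneq b c; first by rewrite tperm2 group1.
  by apply: fH.
have pair a b c d : a != b -> c != d -> tperm a b * tperm c d \in H.
  move=> ab cd; have [ac|ac] := eqVneq a c; first by subst c; rewrite pair1.
  rewrite -[tperm a b]mulg1 -(tperm2 a c) -!mulgA mulgA groupM ?pair1 //.
  by rewrite tpermC pair1; by_neq.
have evens n (ts : seq (T * T)) : size ts = n.*2 -> all dpair ts ->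
    \prod_(t <- ts) tperm t.1 t.2 \in H.
  elim: n ts => [|n IH] [|t [|u ts]] //=; first by rewrite big_nil group1.
  move=> [] /IH IHts /and3P[tP uP /IHts]; rewrite !big_cons mulgA.
  by move=> tsH; rewrite groupM // pair.
apply/subsetP => s; rewrite Alt_even.
have [ts -> tsP] := prod_tpermP s; rewrite odd_perm_prod // => ev.
by apply: (evens (size ts)./2) => //; rewrite even_halfK.
Qed.

End ThreeCycles.

Section AltTransitive.
Variable T : finType.
Implicit Types (A B : {set T}).

(** Both sets are extended to enumerations of all of [T], on which the symmetric
    group is transitive. *)
Lemma Sym_trans_sets A B : #|A| = #|B| -> exists s : {perm T}, s @: A = B.
Proof.
move=> cAB.
have szP (C : {set T}) : size (enum C ++ enum (~: C)) == #|T|.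
  by rewrite size_cat -!cardE cardsC.
have dP C : Tuple (szP C) \in #|T|.-dtuple(setT).
  rewrite inE; apply/andP; split; last by apply/subsetP => x; rewrite inE.
  rewrite /= cat_uniq !enum_uniq andbT /=; apply/hasPn => x.
  by rewrite !mem_enum inE.
have [s _ eqs] := atransP2 (Sym_trans T) (dP A) (dP B).
exists s; have /(congr1 (take #|A| \o val)) /= := eqs.
rewrite {1}cAB map_cat !take_size_cat ?size_map -?cardE // => eB.
apply/setP => x; have <- := mem_enum B x; rewrite eB.
apply/imsetP/mapP => -[y yA ->]; exists y => //; first by rewrite mem_enum.
by rewrite -mem_enum.
Qed.

(** An odd permutation is corrected by a transposition inside [A]. *)
Lemma Alt_trans_sets A B : 1 < #|A| -> #|A| = #|B| ->
  exists2 s : {perm T}, s \in 'Alt_T & s @: A = B.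
Proof.
move=> /card_gt1P[x [y [xA yA xy]]] /Sym_trans_sets[s sAB].
have [odds|evs] := boolP (odd_perm s); last by exists s; rewrite ?Alt_even.
exists (tperm x y * s); first by rewrite Alt_even odd_permM odd_tperm xy odds.
rewrite -sAB; have tA : tperm x y @: A = A.
  apply/eqP; rewrite eqEcard (card_imset _ perm_inj) leqnn andbT.
  by apply/subsetP => _ /imsetP[z zA ->]; case: tpermP.
by rewrite -{2}tA -imset_comp; apply: eq_imset => z; rewrite /= permM.
Qed.

End AltTransitive.

Section Index.
Variable T : finType.
Variables (K H : {group {perm T}}).
Hypotheses (AK : 'Alt_T \subset K) (HK : H \subset K).
Hypothesis AH : ~~ ('Alt_T \subset H).

Lemma card_gt2_Alt : 2 < #|T|.
Proof.
by rewrite ltnNge; apply: contra AH => /trivial_Alt_2 ->; apply: sub1G.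
Qed.

Lemma setactP_imset (A : {set T}) (s : {perm T}) : ('P^*)%act A s = s @: A.
Proof. by []. Qed.

(** Let [M] be maximal with at least three points such that [H] contains the
    alternating group on [M]; then [a] is the size of [M] and [b] the size of its
    orbit under [H].  Two members of the orbit that meet have a union of the same
    kind, hence are equal, so that the orbit consists of disjoint sets.  Comparing
    the stabilisers of [M] in [H] and in [K], the orbit of [M] under [K], which
    consists of all a-sets, has a size that divides [#|K : H| * b]. *)
Lemma index_of_alt_full (F : {set T}) : 3 <= #|F| -> alt_full H F ->
  exists a b, [/\ 3 <= a, a < #|T|, 0 < b, b * a <= #|T| &
                  'C(#|T|, a) %| #|K : H| * b].
Proof.
move=> F3 fF; pose P (A : {set T}) := (3 <= #|A|) && alt_full H A.
have [|M /maxsetP[/andP[M3 fM] maxM]] := @ex_maxset _ P.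
  by exists F; rewrite /P F3.
pose O := orbit 'P^* H M; exists #|M|, #|O|; split=> //.
- rewrite ltnNge; apply: contra AH => MT; apply: alt_full_setT.
  by have /eqP <- : M == setT by rewrite eqEcard subsetT cardsT.
- by apply/card_gt0P; exists M; rewrite orbit_refl.
- have cO A : A \in O -> #|A| = #|M|.
    by move=> /imsetP[s sH ->]; rewrite setactP_imset card_imset //; apply: perm_inj.
  have eqO A : A \in O -> A :&: M != set0 -> A = M.
    move=> AO /set0Pn[c /setIP[cA cM]].
    have fA : alt_full H A.
      by have /imsetP[s sH ->] := AO; rewrite setactP_imset alt_fullJ.
    have AM : A :|: M = M.
      apply: maxM; last exact: subsetUr.
      by rewrite /P (leq_trans M3) ?subset_leq_card ?subsetUr // (alt_full_union _ _ cA cM) ?cO.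
    by apply/eqP; rewrite eqEcard cO // leqnn andbT -AM subsetUl.
  have tO : trivIset O.
    apply/trivIsetP => _ _ /imsetP[s sH ->] /imsetP[t tH ->].
    rewrite !setactP_imset; apply: contraNT => /pred0Pn[x /andP[/imsetP[y yM ->] /imsetP[z zM e]]].
    apply/eqP; have /(congr1 (fun A : {set T} => t @: A)) : (s * t^-1) @: M = M.
      apply: eqO; first by apply/imsetP; exists (s * t^-1); rewrite ?groupM ?groupV.
      apply/set0Pn; exists z; rewrite inE zM andbT; apply/imsetP; exists y => //.
      by rewrite permM e permK.
    move=> <-; rewrite -imset_comp; apply: eq_imset => w /=.
    by rewrite permM permKV.
  rewrite -sum_nat_const -(eq_bigr _ cO).
  rewrite (eqP tO) -cardsT subset_leq_card //; exact: subsetT.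
- rewrite card_orbit Lagrange_index //; last exact: subsetIl.
  have sC : 'C_H[M | 'P^*] \subset 'C_K[M | 'P^*] by rewrite setSI.
  rewrite -(Lagrange_index (subsetIl _ _) sC) -card_orbit.
  suff -> : #|orbit 'P^* K M| = 'C(#|T|, #|M|) by apply: dvdn_mulr.
  rewrite -card_draws; apply: eq_card => A; rewrite inE.
  apply/imsetP/eqP => [[s sK ->]|/esym cA].
    by rewrite setactP_imset card_imset //; apply: perm_inj.
  have [s sA <-] := Alt_trans_sets (ltnW M3) cA.
  by exists s; rewrite ?(subsetP AK).
Qed.

Hypothesis no3 : forall x y z, x != y -> y != z -> x != z -> cyc3 x y z \notin H.

(** Otherwise a Sylow 3-subgroup of [H] is one of [K], and so it contains a
    conjugate of a given 3-cycle. *)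
Lemma dvd3_index_no3 : 3 %| #|K : H|.
Proof.
have [x [y [z [_ _ _ [xy yz zx]]]]] : exists x y z : T,
    [/\ x \in T, y \in T, z \in T & [/\ x != y, y != z & z != x]].
  by have /card_gt2P[x [y [z [[? ? ?] ?]]]] := card_gt2_Alt; exists x, y, z.
have xz : x != z by rewrite eq_sym.
have oz : #[cyc3 x y z] = 3.
  apply: nt_prime_order => //.
    apply/permP => t; rewrite perm1 !expgS expg0 mulg1 !(permM (cyc3 x y z)).
    have [->|tx] := eqVneq t x; first by rewrite cyc3_1 // cyc3_2 cyc3_3.
    have [->|ty] := eqVneq t y; first by rewrite cyc3_2 cyc3_3 // cyc3_1.
    have [->|tz] := eqVneq t z; first by rewrite cyc3_3 // cyc3_1 // cyc3_2.
    by rewrite !cyc3_fix // eq_sym.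
  by apply: (contra_neq _ xy) => /permP/(_ x); rewrite perm1 cyc3_1 // => ->.
apply: contraT => n3; have [P sylP] := Sylow_exists 3 H.
have sylK : 3.-Sylow(K) P.
  rewrite pHallE (subset_trans (pHall_sub sylP) HK) /= (card_Hall sylP).
  by rewrite -(Lagrange HK) partnM // ?indexg_gt0 // (@part_p'nat _ #|K : H|) ?muln1 // p'natE.
have cK : <[cyc3 x y z]> \subset K.
  rewrite cycle_subG (subsetP AK) // Alt_even odd_permM !odd_tperm.
  by rewrite xy xz.
have [|s sK] := Sylow_Jsub sylK cK; first by rewrite /pgroup -orderE oz pnat_id.
move/subset_trans/(_ (pHall_sub sylP))/subsetP/(_ (cyc3 x y z ^ s)).
rewrite memJ_conjg cycle_id => /(_ isT); rewrite cyc3J => sH.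
by rewrite (negPf (no3 _ _ _)) // ?(inj_eq perm_inj) in sH.
Qed.

(** If the supports of [h] and [g] meet in the single point [a], then conjugating
    [h] by [g] has the same effect as conjugating it by the transposition of [a]
    and [g a], because the quotient of the two conjugators fixes the support
    [D] of [h]. *)
Lemma commg_cyc3 (g h : {perm T}) (D : {set T}) a :
  a \in D -> perm_on D h -> h a != a -> g a != a ->
  (forall x, x \in D -> x != a -> g x = x) ->
  [~ h, g] = cyc3 (g a) (h a) a.
Proof.
move=> aD hD ha ga gD.
have hfix x : x \notin D -> h x = x by apply: out_perm.
have haD : h a \in D by rewrite perm_closed.
have gaD : g a \notin D.
  apply/negP => gaD; case/eqP: (ga); apply: (@perm_inj _ g); exact: gD.
pose t := tperm a (g a).
have hgt : h ^ g = h ^ t.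
  suff hu : h ^ (g * t^-1) = h by rewrite -{2}hu -conjgM mulgKV.
  apply/conjg_fixP/commgP; apply: (perm_onC hD (S2 := ~: D)); last first.
    by rewrite -setI_eq0 setICr.
  apply/subsetP => x; rewrite !inE; apply: contra => xD; rewrite permM tpermV.
  have [->|xa] := eqVneq x a; first by rewrite tpermR.
  rewrite (gD x) // tpermD // 1?eq_sym //.
  by apply: contraNneq gaD => <-.
rewrite commgEl hgt (conjgE h t) !mulgA -[h^-1 * t^-1 * h]mulgA -conjgE tpermV tpermJ.
by rewrite (hfix _ gaD) /cyc3 /t tpermC (tpermC a).
Qed.

(** Bochert's argument.  Let [D] be a smallest set of points whose pointwise
    stabiliser in [H] is trivial.  If [D] contained more than half of the points,
    then some [h != 1] in [H] would be supported in [D], and for a point [a] moved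
    by [h] some [g != 1] in [H] would fix all other points of [D]; the commutator
    of [h] and [g] would be a 3-cycle.  So the complement of [D] contains at least
    half of the points, and the permutations of this complement, of which at
    least half belong to [K], lie in distinct cosets of [H]. *)
Lemma uphalf_fact_le_index_no3 : (uphalf #|T|)`! <= 2 * #|K : H|.
Proof.
pose P (D : {set T}) := 'C_H(D | 'P) \subset [1 {perm T}].
have PT : P setT.
  apply/subsetP => s /setIP[_ /astabP sT]; apply/set1P/permP => x.
  by rewrite perm1 -[RHS](sT x) ?inE.
have [D PD minD] := @arg_minnP _ setT P (fun D => #|D|) PT.
have nP (E : {set T}) : #|E| < #|D| ->
    exists s : {perm T}, [/\ s \in H, s != 1 & forall x, x \in E -> s x = x].
  move=> ED; have /subsetPn[s /setIP[sH /astabP sE] s1] : ~~ P E.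
    by apply: contraL ED => /minD; rewrite -leqNgt.
  by exists s; split=> [//||x /sE //]; rewrite -in_set1.
have leD : #|D| <= #|~: D|.
  rewrite leqNgt; apply/negP => /nP[h [hH h1 hC]].
  have hD : perm_on D h.
    by apply/subsetP => x; apply: contraR => xD; rewrite hC // inE.
  have [a ha] : exists a, h a != a.
    apply/existsP; apply: contra_neqT h1; rewrite negb_exists => /forallP h1.
    by apply/permP => x; rewrite perm1; apply/eqP; rewrite -[_ == _]negbK.
  have aD : a \in D by apply: (subsetP hD).
  have [g [gH g1 gC]] := nP (D :\ a) (proper_card (properD1 aD)).
  have gD x : x \in D -> x != a -> g x = x by move=> xD xa; rewrite gC // !inE xa.
  have ga : g a != a.
    apply: contra_neq g1 => ga; apply/set1P/(subsetP PD).
    rewrite inE gH; apply/astabP => x xD; rewrite /= /aperm.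
    by have [->|] := eqVneq x a; last exact: gD.
  have /negP[] : [~ h, g] \notin H; last by rewrite groupR.
  have gaD : g a \notin D.
    by apply/negP => gaD; case/eqP: (ga); apply: (@perm_inj _ g); exact: gD.
  rewrite (commg_cyc3 aD hD ha ga gD) no3 //.
  by apply: contraNneq gaD => ->; rewrite perm_closed.
pose V := 'C(D | @perm_action T)%G.
have cV : #|V| = #|~: D|`!.
  rewrite -card_perm; apply: eq_card => s; apply/astabP/subsetP => [sD x | sD x xD].
    by rewrite !inE; apply: contra => /sD xx; apply/eqP.
  by apply/eqP; apply: contraLR xD => /sD; rewrite inE.
have tKH : (V :&: K) :&: H \subset [1 {perm T}].
  apply: subset_trans PD; rewrite subsetI subsetIr /=.
  by rewrite -setIA subsetIl.
have VA : #|V| <= 2 * #|V :&: K|.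
  rewrite -(leq_pmul2r (cardG_gt0 'Alt_T)) mulnAC card_Alt; last exact: ltnW card_gt2_Alt.
  rewrite mul_cardG -card_Sym leq_mul ?subset_leq_card ?subsetT //.
  by rewrite setIS.
have VK : #|V :&: K| <= #|K : H|.
  rewrite -(leq_pmul2r (cardG_gt0 H)) mulnC [X in _ <= X]mulnC Lagrange // mulnC.
  have t1 : #|(V :&: K) :&: H| = 1%N by rewrite (trivgP tKH) cards1.
  rewrite mul_cardG t1 muln1.
  by rewrite subset_leq_card // mul_subG // subsetIr.
rewrite (leq_trans _ (leq_mul (leqnn 2) VK)) // (leq_trans _ VA) // cV.
have : uphalf #|T| <= #|~: D|.
  by move: leD; rewrite -(cardsC D) uphalfE; lia.
exact: leq_fact.
Qed.

(** The alternating group is simple, so it acts faithfully on the cosets of [H];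
    a half of [#|T|`!] is therefore at most [#|K : H|`!]. *)
Lemma deg_le_index_no3 : 4 < #|T| -> #|T| <= #|K : H|.
Proof.
move=> n5; have sA := simple_Alt5 n5.
have nC : gcore H K :&: 'Alt_T <| 'Alt_T.
  rewrite /normal subsetIr normsI ?normG //.
  exact: subset_trans AK (gcore_norm _ _).
have tC : gcore H K :&: 'Alt_T = 1.
  have [//|eA] := (simpleP _ sA).2 _ nC; case/negP: AH.
  by rewrite -eA subIset // gcore_sub.
pose R := rcosets H K.
have nRA : [acts 'Alt_T, on R | 'Rs] by rewrite (subset_trans AK) ?actsRs_rcosets.
pose f a := actperm <[nRA]> a.
have fP : {in 'Alt_T &, injective f}.
  apply/injmP; rewrite ker_actperm astab_actby setIT astabRs_rcosets.
  by rewrite setIC tC.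
have : #|f @: 'Alt_T| <= #|R|`!.
  rewrite -card_perm subset_leq_card //; apply/subsetP => _ /imsetP[a aA ->].
  apply/subsetP => X; rewrite inE actpermE; apply: contraR => XR.
  by rewrite /= /actby (negPf XR).
rewrite card_in_imset // -(leq_pmul2l (isT : 0 < 2)) card_Alt; last by lia.
rewrite [#|R|]/(#|K : H|) => le; rewrite leqNgt; apply/negP => lt.
have /leq_fact le' : #|K : H| <= #|T|.-1 by lia.
have eT : #|T|`! = (#|T| * #|T|.-1`!)%N by rewrite -(prednK (ltn_trans _ n5)).
have := leq_mul n5 (leqnn #|T|.-1`!); have := fact_gt0 #|T|.-1.
by move: le le' eT; set a := #|T|`!; set b := #|T|.-1`!; set c := #|K : H|`!; lia.
Qed.

End Index.

End SubgroupIndices.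

(** * Sums over the divisors of a factorial *)

Section DivisorSums.
Import Order.TTheory GRing.Theory Num.Theory.
Local Open Scope ring_scope.
Local Notation inv d := ((d%:R : rat)^-1).

Lemma ler_sum_sub (I : eqType) (R : numDomainType) (f : I -> R) (s t : seq I) :
  (forall i, 0 <= f i) -> uniq s -> {subset s <= t} ->
  \sum_(i <- s) f i <= \sum_(i <- t) f i.
Proof.
move=> f0; elim: s t => [|x s IH] t /=; first by rewrite big_nil sumr_ge0.
move=> /andP[xs us] st; have xt : x \in t by rewrite st ?mem_head.
rewrite big_cons (perm_big _ (perm_to_rem xt)) big_cons lerD2l IH // => y ys.
have := st y; rewrite inE ys orbT (perm_mem (perm_to_rem xt)) inE => /(_ isT).
by case: eqVneq ys xs => [-> ->|].
Qed.

Lemma dvdn_mul_split d a b : (0 < a)%N -> (d %| a * b)%N ->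
  exists2 x, (x %| a)%N & exists2 y, (y %| b)%N & d = (x * y)%N.
Proof.
move=> a0 dab; exists (gcdn d a); first exact: dvdn_gcdr.
exists (d %/ gcdn d a)%N; last by rewrite mulnC divnK ?dvdn_gcdl.
have g0 : (0 < gcdn d a)%N by rewrite gcdn_gt0 a0 orbT.
rewrite -(@Gauss_dvdr _ (a %/ gcdn d a)).
  by rewrite -(dvdn_pmul2r g0) divnK ?dvdn_gcdl // mulnAC divnK ?dvdn_gcdr.
rewrite /coprime -(eqn_pmul2r g0) mul1n muln_gcdl.
by rewrite !divnK ?dvdn_gcdl ?dvdn_gcdr.
Qed.

Section Multiplicative.
Variable f : nat -> rat.
Hypotheses (f_ge0 : forall n, 0 <= f n) (f1 : f 1%N = 1).
Hypothesis fM : forall m n, f (m * n)%N = f m * f n.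

Lemma multX p j : f (p ^ j)%N = f p ^+ j.
Proof. by elim: j => [|j IH]; rewrite ?f1 // expnS fM IH exprS. Qed.

(** The Euler product, by induction on a bound for the primes.  Each divisor of
    [k * p ^ e] is a divisor of [k] times a power of [p], which suffices for an
    inequality. *)
Lemma sum_divisors_le B m : (0 < m)%N ->
  (forall p, prime p -> (p %| m)%N -> (p < B)%N) ->
  \sum_(d <- divisors m) f d <=
  \prod_(0 <= p < B | prime p) \sum_(0 <= j < (logn p m).+1) f p ^+ j.
Proof.
elim: B m => [|B IH] m m0 mB.
  have -> : m = 1%N.
    apply/eqP; rewrite eqn_leq m0 andbT leqNgt; apply/negP => m1.
    by have := mB _ (pdiv_prime m1) (pdiv_dvd m).
  by rewrite big_nil big_seq1 f1.
rewrite [X in _ <= X]big_mkcond big_nat_recr //= -big_mkcond /=.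
case: ifP => [pB|npB]; last first.
  rewrite mulr1 IH // => p pp pm; have := mB _ pp pm; rewrite ltnS leq_eqVlt.
  by case: eqP pp npB => // -> ->.
have [k coBk mE] := pfactor_coprime pB m0; set e := logn B m in mE *.
have k0 : (0 < k)%N by move: m0; rewrite mE muln_gt0 => /andP[].
have lk p : (p < B)%N -> logn p m = logn p k.
  move=> pltB; rewrite mE lognM // ?expn_gt0 ?prime_gt0 // lognX (logn_prime p pB).
  by rewrite (ltn_eqF pltB) muln0 addn0.
have -> : \prod_(0 <= p < B | prime p) \sum_(0 <= j < (logn p m).+1) f p ^+ j
        = \prod_(0 <= p < B | prime p) \sum_(0 <= j < (logn p k).+1) f p ^+ j.
  rewrite big_nat_cond [RHS]big_nat_cond.
  by apply: eq_bigr => p /andP[/andP[_ pltB] pp]; rewrite lk.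
apply: le_trans (_ : (\sum_(d <- divisors k) f d) *
   \sum_(0 <= j < e.+1) f B ^+ j <= _); last first.
  apply: ler_wpM2r; first by apply: sumr_ge0 => j _; apply: exprn_ge0.
  apply: IH => // p pp pk; have := mB p pp; rewrite {1}mE dvdn_mulr // => /(_ isT).
  rewrite ltnS leq_eqVlt => /orP[/eqP pe|//].
  by move: coBk; rewrite -pe prime_coprime // pk.
rewrite mulr_suml; under [X in _ <= X]eq_bigr do rewrite mulr_sumr.
pose t := [seq (x * B ^ j)%N | x <- divisors k, j <- index_iota 0 e.+1].
have -> : \sum_(x <- divisors k) \sum_(0 <= j < e.+1) f x * f B ^+ j
        = \sum_(x <- t) f x.
  rewrite /t big_allpairs_dep; apply: eq_bigr => x _; apply: eq_bigr => j _.
  by rewrite fM multX.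
apply: ler_sum_sub => // [|d]; first exact: divisors_uniq.
rewrite -dvdn_divisors // {1}mE => /(dvdn_mul_split k0)[x xk [y yB ->]].
have /(dvdn_pfactor _ _ pB)[j je ->] := yB.
by apply: allpairs_f; rewrite -?dvdn_divisors // mem_index_iota ltnS.
Qed.

End Multiplicative.

Lemma prime_dvd_fact p n : prime p -> (p %| n`!)%N -> (p < n.+1)%N.
Proof.
move=> pp; elim: n => [|n IH]; first by rewrite fact0 dvdn1 => /eqP pe; rewrite pe in pp.
by rewrite factS Euclid_dvdM // => /orP[/(dvdn_leq (ltn0Sn n))|/IH]; lia.
Qed.

(** The number of divisors of [n`!]. *)
Definition tau_fact n := (\prod_(0 <= p < n.+1 | prime p) (logn p n`!).+1)%N.

Lemma size_divisors_fact n : (size (divisors n`!) <= tau_fact n)%N.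
Proof.
have := sum_divisors_le (f := fun=> 1) (fun=> ler01) erefl (fun _ _ => esym (mulr1 1))
  (fact_gt0 n) (fun p pp => prime_dvd_fact pp).
rewrite big_const_seq count_predT iter_addr_0 => le.
rewrite -(ler_nat rat) (le_trans le) // natr_prod le_eqVlt; apply/orP; left.
apply/eqP; apply: eq_bigr => p _.
under eq_bigr do rewrite expr1n.
by rewrite big_const_nat iter_addr_0 subn0.
Qed.

(** The infinite version of the Euler product for the sum of the reciprocals of
    the divisors of [n`!]: it depends on [n] only through the primes up to [n], and
    this makes the step from [n] to [n.+1] trivial. *)
Definition sigma_fact n : rat := \prod_(0 <= p < n.+1 | prime p) (p%:R / p.-1%:R).

Lemma sum_inv_divisors_fact n : \sum_(d <- divisors n`!) inv d <= sigma_fact n.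
Proof.
apply: le_trans (sum_divisors_le (f := fun d => inv d) _ _ _
  (fact_gt0 n) (fun p pp => prime_dvd_fact pp)) _.
- by move=> m; rewrite invr_ge0.
- by [].
- by move=> a b; rewrite natrM invfM.
apply: ler_prod => p pp; apply/andP; split.
  by apply: sumr_ge0 => j _; rewrite exprn_ge0 // invr_ge0.
have p1 := prime_gt1 pp.
have p0 : 0 < p.-1%:R :> rat by rewrite ltr0n -ltnS prednK // ltnW.
have pE : p%:R = p.-1%:R + 1 :> rat by rewrite natr1 prednK // ltnW.
have pp0 : 0 < p%:R :> rat by rewrite ltr0n ltnW.
rewrite ler_pdivlMr // big_mkord.
have -> : p.-1%:R = p%:R * (1 - inv p) by rewrite mulrBr mulfV ?lt0r_neq0 // mulr1 pE addrK.
rewrite mulrCA -[X in _ <= X]mulr1 ler_pM2l // mulrC -opprB mulNr -subrX1 opprB.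
by rewrite gerBl exprn_ge0 // invr_ge0.
Qed.

(** The new factor is at most [p / p.-1] for [p = n.+1]. *)
Lemma sigma_factS n : (0 < n)%N -> sigma_fact n.+1 <= sigma_fact n * (n.+1%:R / n%:R).
Proof.
move=> n0; have nn : 0 < n%:R :> rat by rewrite ltr0n.
have s0 : 0 <= sigma_fact n.
  by apply: prodr_ge0 => p _; rewrite divr_ge0.
rewrite {1}/sigma_fact big_mkcond big_nat_recr // -big_mkcond -/(sigma_fact n).
have le1 : 1 <= n.+1%:R / n%:R :> rat by rewrite ler_pdivlMr // mul1r ler_nat.
by apply: ler_wpM2l => //; case: ifP.
Qed.

Lemma sigma_fact16 : sigma_fact 16 <= 16%:R / 3%:R.
Proof.
rewrite /sigma_fact big_mkcond /index_iota /= !big_cons big_nil /=; lra.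
Qed.

(** By the previous steps the quotient of [sigma_fact n] by [n] decreases. *)
Lemma sigma_fact_le n : (16 <= n)%N -> sigma_fact n <= n%:R / 3%:R.
Proof.
elim: n => // n IH; rewrite leq_eqVlt => /orP[/eqP <-|]; first exact: sigma_fact16.
rewrite ltnS => n16; apply: le_trans (sigma_factS (ltn_trans _ n16)) _ => //.
have nn : 0 < n%:R :> rat by rewrite ltr0n (leq_trans _ n16).
have := IH n16; rewrite ler_pdivlMr // => le.
rewrite mulrA ler_pdivrMr // mulrAC ler_pdivlMr //.
have : 0 <= n.+1%:R :> rat by [].
by set a := n.+1%:R; set b := n%:R in le *; nra.
Qed.

(** An elementary substitute for the bound of the product by the exponential of
    the sum. *)
Lemma prod1D_le (I : Type) (r : seq I) (P : pred I) (x : I -> rat) :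
  (forall i, P i -> 0 <= x i) -> \sum_(i <- r | P i) x i <= 1 ->
  \prod_(i <- r | P i) (1 + x i) <=
    1 + \sum_(i <- r | P i) x i + (\sum_(i <- r | P i) x i) ^+ 2.
Proof.
move=> x0; elim: r => [|i r IH]; first by rewrite !big_nil.
rewrite !big_cons; case: ifP => // Pi.
have S0 : 0 <= \sum_(j <- r | P j) x j by apply: sumr_ge0.
set S := \sum_(j <- r | P j) x j in IH S0 *; set M := \prod_(j <- r | P j) _ in IH *.
have := x0 _ Pi; move: (x i) => y y0 yS.
have le : M <= 1 + S + S ^+ 2 by apply: IH; lra.
apply: le_trans (_ : (1 + y) * (1 + S + S ^+ 2) <= _).
  by rewrite ler_wpM2l //; lra.
have : 0 <= S * y * (1 - S) by rewrite mulr_ge0 ?mulr_ge0 //; lra.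
rewrite !expr2; nra.
Qed.

(** The sum of the prime factors of [n], with multiplicity, is at most their
    product, because [q + m <= q * m] for [q] and [m] at least 2. *)
Lemma sum_logn_le B n : (1 < n)%N -> (\sum_(0 <= p < B | prime p) logn p n * p <= n)%N.
Proof.
elim/ltn_ind: n => n IH n1.
have pq := pdiv_prime n1; set q := pdiv n in pq.
have nE : n = (q * (n %/ q))%N by rewrite mulnC divnK // pdiv_dvd.
set m := (n %/ q)%N in nE.
have m0 : (0 < m)%N by rewrite divn_gt0 ?prime_gt0 // dvdn_leq ?pdiv_dvd // ltnW.
have q1 := prime_gt1 pq.
have sq : (\sum_(0 <= p < B | prime p) logn p q * p <= q)%N.
  under eq_bigr do rewrite logn_prime //.
  apply: leq_trans (_ : \sum_(0 <= p < B | p == q) q <= _)%N.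
    rewrite [X in (X <= _)%N]big_mkcond [X in (_ <= X)%N]big_mkcond.
    by apply: leq_sum => p _; case: ifP; case: eqP => [->|]; rewrite ?mul1n.
  by rewrite big_nat1_eq; case: ifP.
have lE p : (logn p n * p = logn p q * p + logn p m * p)%N.
  by rewrite {1}nE lognM // ?mulnDl // prime_gt0.
under eq_bigr do rewrite lE.
rewrite big_split /=.
have [m1|m1] := leqP m 1.
  have me : m = 1%N by apply/eqP; rewrite eqn_leq m1.
  rewrite nE me muln1 [X in (_ + X)%N]big1 ?addn0 // => p _; by rewrite logn1.
have mn : (m < n)%N by rewrite nE; nia.
have IHm := IH m mn m1; rewrite nE; apply: leq_trans (leq_add sq IHm) _; nia.
Qed.

Lemma leq_div_logn_fact p n : prime p -> (p <= n)%N -> (n %/ p <= logn p n`!)%N.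
Proof.
move=> pp pn; rewrite logn_fact // big_ltn ?expn1 ?leq_addr //.
by rewrite ltnS (leq_trans _ pn) ?prime_gt0.
Qed.

(** Passing from [n`!] to [N`!] multiplies the number of divisors by the product
    of [1 + x p], where [x p] is the quotient of [logn p N] by [(logn p n`!).+1].
    Since [n`!] is divisible by a power of [p] with exponent at least
    [N / p - 1] when [p] divides [N], the sum of all [x p] is at most the sum of
    the prime factors of [N] divided by [N], hence at most 1. *)
Lemma tau_factS n : (0 < n)%N -> (tau_fact n.+1 <= 3 * tau_fact n)%N.
Proof.
move=> n0; set N := n.+1.
have N1 : (1 < N)%N by [].
pose x p : rat := (logn p N)%:R / (logn p n`!).+1%:R.
have tE : (tau_fact N)%:R = (tau_fact n)%:R * \prod_(0 <= p < N.+1 | prime p) (1 + x p) :> rat.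
  have -> : tau_fact n = (\prod_(0 <= p < N.+1 | prime p) (logn p n`!).+1)%N.
    rewrite [RHS]big_mkcond big_nat_recr //= -big_mkcond -/(tau_fact n).
    case: ifP => [Np|]; last by rewrite muln1.
    suff -> : logn N n`! = 0%N by rewrite muln1.
    apply/eqP; rewrite -leqn0 leqNgt logn_gt0 mem_primes fact_gt0 Np /=.
    by apply/negP => /(prime_dvd_fact Np); rewrite ltnn.
  rewrite !natr_prod -big_split; apply: eq_bigr => p pp /=.
  rewrite mulrDr mulr1 mulrC divfK ?pnatr_eq0 // -natrD; congr _%:R.
  by rewrite factS lognM ?fact_gt0 // -/N; lia.
have Sle : \sum_(0 <= p < N.+1 | prime p) x p <= 1.
  have := sum_logn_le N.+1 N1; rewrite -(ler_nat rat) natr_sum => le.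
  have N0 : 0 < N%:R :> rat by rewrite ltr0n.
  rewrite -(ler_pM2r N0) mul1r mulr_suml (le_trans _ le) // ler_sum // => p pp.
  rewrite /x mulrAC ler_pdivrMr ?ltr0n // -!natrM ler_nat.
  have [->//|l0] := posnP (logn p N); rewrite -mulnA leq_pmul2l //.
  have pN : (p %| N)%N by move: l0; rewrite logn_gt0 mem_primes => /and3P[].
  have [->|pn] := eqVneq p N; first by rewrite leq_pmulr.
  have pN' : (p <= n)%N by move: (dvdn_leq (ltn0Sn n) pN); rewrite leq_eqVlt (negPf pn).
  have := leq_div_logn_fact pp pN' => le1.
  have p0 := prime_gt0 pp.
  have : (N %/ p <= (n %/ p).+1)%N by rewrite /N divnS //; case: (_ %| _)%N; lia.
  by rewrite -{2}(divnK pN) mulnC; move=> le2; rewrite leq_pmul2l //; lia.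
have S0 : 0 <= \sum_(0 <= p < N.+1 | prime p) x p.
  by apply: sumr_ge0 => p _; rewrite divr_ge0.
have x0 p : prime p -> 0 <= x p by move=> _; rewrite divr_ge0.
have le := prod1D_le x0 Sle.
rewrite -(ler_nat rat) tE mulnC natrM ler_wpM2l //; apply: le_trans le _.
by move: S0 Sle; set S := \sum_(_ <= _ < _ | _) _; rewrite expr2; nra.
Qed.

(** Unlike Legendre's formula, this one evaluates without computing large
    powers. *)
Lemma logn_fact_sum p n : logn p n`! = (\sum_(1 <= k < n.+1) logn p k)%N.
Proof.
elim: n => [|n IH]; first by rewrite big_geq // logn1.
by rewrite big_nat_recr //= -IH factS lognM ?fact_gt0 // addnC.
Qed.

Lemma tau_factE n : tau_fact n =
  (\prod_(0 <= p < n.+1 | prime p) (\sum_(1 <= k < n.+1) logn p k).+1)%N.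
Proof. by apply: eq_bigr => p pp; rewrite logn_fact_sum. Qed.

Lemma tau_fact17 : tau_fact 17 = (16 * (7 * (4 * (3 * (2 * (2 * 2))))))%N.
Proof. by rewrite tau_factE unlock; vm_compute. Qed.

Lemma tau_fact18 : tau_fact 18 = (17 * (9 * (4 * (3 * (2 * (2 * 2))))))%N.
Proof. by rewrite tau_factE unlock; vm_compute. Qed.

(** Two steps multiply the left-hand side by at most 9 and the right-hand side by
    at least 9. *)
Lemma tau_fact_le n : (17 <= n)%N -> (16 * tau_fact n <= (uphalf n)`!)%N.
Proof.
elim/ltn_ind: n => n IH n17.
have [->|n1] := eqVneq n 17; first by rewrite tau_fact17 [uphalf _]/= !factS fact0; lia.
have [->|n2] := eqVneq n 18; first by rewrite tau_fact18 [uphalf _]/= !factS fact0; lia.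
case: n IH n17 n1 n2 => [|[|n]] // IH n17 n1 n2.
have h := IH n (ltnW (ltnSn _)); have n17' : (17 <= n)%N by lia.
have {}h := h n17'.
have t1 := tau_factS (ltn0Sn n); have t2 := tau_factS (leq_trans (isT : 0 < 17)%N n17').
rewrite -[uphalf n.+2]/(uphalf n).+1 factS.
have : (9 <= uphalf n)%N by rewrite uphalfE; lia.
move: h t1 t2; set f := (uphalf n)`!; set a := tau_fact n; set b := tau_fact n.+1.
set c := tau_fact n.+2; set u := uphalf n => h t1 t2 u9.
have : (9 * f <= u.+1 * f)%N by rewrite leq_mul2r (leq_trans u9) ?orbT.
by lia.
Qed.

End DivisorSums.

(** * Sums of reciprocals of admissible divisors *)

Section AdmissibleSums.
Import Order.TTheory GRing.Theory Num.Theory.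
Local Open Scope ring_scope.
Local Notation inv d := ((d%:R : rat)^-1).

(** The condition on the index of a subgroup that contains a 3-cycle. *)
Definition orbit_admissible n d :=
  exists a b, [/\ (3 <= a)%N, (a < n)%N, (0 < b)%N, (b * a <= n)%N &
                  ('C(n, a) %| d * b)%N].

(** What is used about the index [d], in the symmetric or the alternating group
    of degree [n], of a subgroup that does not contain the alternating group. *)
Definition admissible n d :=
  [/\ (3 %| d)%N, ((uphalf n)`! <= 2 * d)%N & (4 < n)%N -> (n <= d)%N]
  \/ orbit_admissible n d.

(** The condition says that [d] is a multiple of [M], the quotient of [C] by
    [gcdn C b], which is at least [C / b]; dividing by [M] maps the [d] injectively
    to divisors of [N]. *)
Lemma sum_inv_dvd_le N C b (s : seq nat) : (0 < N)%N -> (0 < C)%N -> (0 < b)%N ->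
  uniq s -> {in s, forall d, (d %| N)%N} ->
  \sum_(d <- s | (C %| d * b)%N) inv d <=
  b%:R / C%:R * \sum_(d <- divisors N) inv d.
Proof.
move=> N0 C0 b0 us sN; set g := gcdn C b.
have g0 : (0 < g)%N by rewrite gcdn_gt0 C0.
have gC : (g %| C)%N by apply: dvdn_gcdl.
pose M := (C %/ g)%N.
have M0 : (0 < M)%N by rewrite divn_gt0 // dvdn_leq.
have Md d : (C %| d * b)%N -> (M %| d)%N.
  move=> Cdb; rewrite -(@Gauss_dvdl M d (b %/ g)).
    by rewrite -(dvdn_pmul2r g0) divnK // -mulnA divnK // dvdn_gcdr.
  by rewrite /coprime -(eqn_pmul2r g0) mul1n muln_gcdl !divnK // dvdn_gcdr.
apply: le_trans (_ : inv M * \sum_(d <- divisors N) inv d <= _); last first.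
  apply: ler_wpM2r; first by apply: sumr_ge0 => d _; rewrite invr_ge0.
  rewrite ler_pdivlMr ?ltr0n // mulrC ler_pdivrMr ?ltr0n // -natrM ler_nat.
  by rewrite -(divnK gC) -/M mulnC leq_mul2r dvdn_leq ?orbT // dvdn_gcdr.
pose t := [seq (d %/ M)%N | d <- s & (C %| d * b)%N].
have -> : \sum_(d <- s | (C %| d * b)%N) inv d = inv M * \sum_(e <- t) inv e.
  rewrite big_map big_filter mulr_sumr; apply: eq_bigr => d /Md Mdd.
  by rewrite -invfM -natrM mulnC divnK.
apply: ler_wpM2l; first by rewrite invr_ge0.
apply: ler_sum_sub => [e||e]; first by rewrite invr_ge0.
  rewrite map_inj_in_uniq ?filter_uniq // => d d'.
  rewrite !mem_filter => /andP[/Md Mdd _] /andP[/Md Mdd' _] e.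
  by rewrite -(divnK Mdd) e divnK.
move=> /mapP[d]; rewrite mem_filter => /andP[/Md Mdd /sN dN] ->.
by rewrite -dvdn_divisors // (dvdn_trans _ dN) // -{2}(divnK Mdd) dvdn_mulr.
Qed.

Lemma ler_sum_mem (I : eqType) (s : seq I) (f : I -> rat) i :
  (forall j, 0 <= f j) -> i \in s -> f i <= \sum_(j <- s) f j.
Proof.
move=> f0 si; rewrite -(big_seq1 +%R i f); apply: ler_sum_sub => // j.
by rewrite inE => /eqP ->.
Qed.

(** The factor that [sum_inv_dvd_le] produces, summed over all possible shapes
    of an orbit. *)
Definition orbit_weight n : rat :=
  \sum_(3 <= a < n) \sum_(1 <= b < (n %/ a).+1) b%:R / 'C(n, a)%:R.

(** The terms of the first kind are bounded by their number times the largest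
    one, and those of the second kind by a union bound over the shapes [a], [b]. *)
Lemma sum_inv_admissible_le n (s : seq nat) : uniq s ->
  {in s, forall d, (d %| n`!)%N /\ admissible n d} ->
  \sum_(d <- s) inv d <=
  (2 * tau_fact n)%:R / (uphalf n)`!%:R + orbit_weight n * sigma_fact n.
Proof.
move=> us sP; pose F := (uphalf n)`!; have F0 : (0 < F)%N by apply: fact_gt0.
have n0 := fact_gt0 n.
have d0 d : d \in s -> (0 < d)%N by move=> /sP[dn _]; apply: dvdn_gt0 dn.
pose c a b d := ('C(n, a) %| d * b)%N.
apply: le_trans (_ : \sum_(d <- s) (2%:R / F%:R +
   \sum_(3 <= a < n) \sum_(1 <= b < (n %/ a).+1) if c a b d then inv d else 0) <= _).
  rewrite big_seq [X in _ <= X]big_seq; apply: ler_sum => d ds.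
  have t0 : 0 <= \sum_(3 <= a < n) \sum_(1 <= b < (n %/ a).+1)
              (if c a b d then inv d else 0).
    apply: sumr_ge0 => a _; apply: sumr_ge0 => b _.
    by case: ifP => _ //; rewrite invr_ge0.
  have F2 : 0 <= 2%:R / F%:R :> rat by rewrite divr_ge0.
  case: (sP d ds).2 => [[_ Fd _]|[a [b [a3 an b1 ban cd]]]].
    have dF : inv d <= 2%:R / F%:R.
      rewrite ler_pdivlMr ?ltr0n // mulrC.
      by rewrite ler_pdivrMr ?ltr0n ?d0 // -natrM ler_nat.
    by rewrite -[X in X <= _]addr0 lerD.
  rewrite -[X in X <= _]add0r lerD // {t0 F2}.
  pose g a' b' : rat := if c a' b' d then inv d else 0.
  have g0 a' b' : 0 <= g a' b' by rewrite /g; case: ifP => _ //; rewrite invr_ge0.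
  have gd : g a b = inv d by rewrite /g /c cd.
  rewrite -[X in X <= _]gd; apply: le_trans (_ : \sum_(1 <= b' < (n %/ a).+1) g a b' <= _).
    apply: (@ler_sum_mem _ _ (g a)) => //.
    by rewrite mem_index_iota b1 ltnS leq_divRL // (leq_trans _ a3).
  apply: (@ler_sum_mem _ _ (fun a' => \sum_(1 <= b' < (n %/ a').+1) g a' b')).
    by move=> a'; apply: sumr_ge0.
  by rewrite mem_index_iota a3.
rewrite big_split lerD //=.
  rewrite big_const_seq count_predT iter_addr_0 natrM mulrAC -[X in X <= _]mulr_natr.
  apply: ler_wpM2l; first by rewrite divr_ge0.
  rewrite ler_nat (leq_trans _ (size_divisors_fact n)) //.
  by apply: uniq_leq_size => // d /sP[dn _]; rewrite -dvdn_divisors.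
rewrite /orbit_weight exchange_big mulr_suml.
rewrite big_nat_cond [X in _ <= X]big_nat_cond.
apply: ler_sum => a /andP[/andP[a3 an] _].
rewrite exchange_big mulr_suml big_nat_cond [X in _ <= X]big_nat_cond.
apply: ler_sum => b /andP[/andP[b1 bn] _].
rewrite -big_mkcond /=.
apply: le_trans (sum_inv_dvd_le n0 _ b1 us _) _.
- by rewrite bin_gt0 ltnW.
- by move=> d /sP[].
by apply: ler_wpM2l (sum_inv_divisors_fact n); rewrite divr_ge0.
Qed.

(** Binomial coefficients increase up to the middle and are symmetric. *)
Lemma leq_bin_middle n j a : (j <= a)%N -> (a + j <= n)%N -> ('C(n, j) <= 'C(n, a))%N.
Proof.
have up i : (i.*2 < n)%N -> ('C(n, i) <= 'C(n, i.+1))%N.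
  move=> i2; rewrite -(leq_pmul2l (ltn0Sn i)) mul_bin_left leq_mul2r.
  by rewrite orbC; apply/orP; left; lia.
have half i : (j <= i)%N -> (i.*2 <= n)%N -> ('C(n, j) <= 'C(n, i))%N.
  elim: i => [|i IH]; first by rewrite leqn0 => /eqP ->.
  rewrite leq_eqVlt => /orP[/eqP ->//|]; rewrite ltnS => ji i2.
  by apply: leq_trans (IH ji _) (up _ _); lia.
move=> ja ajn; case: (leqP a.*2 n) => a2; first exact: half.
by rewrite -(bin_sub (n := n) (m := a)) ?half; lia.
Qed.

Lemma sum_iota_rat q : \sum_(1 <= b < q.+1) b%:R = q%:R * (q%:R + 1) / 2%:R :> rat.
Proof.
elim: q => [|q IH]; first by rewrite big_geq // mul0r mul0r.
rewrite big_nat_recr //= IH -(natr1 q); by field.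
Qed.

(** In terms of [x = n - 3]: [u] stands for the shapes with [a = 3], [v] for those
    with [4 <= a <= n - 4], and the other summands are exactly those with
    [a = n - 3], [n - 2] and [n - 1].  Multiplied by [n = x + 3] the five summands
    are at most [12/25], [33/40], [1/40], [1/8] and [1]. *)
Lemma orbit_weight_poly_le (x u v : rat) : 14%:R <= x ->
  u <= (x + 3%:R) / 3%:R * ((x + 3%:R) / 3%:R + 1) / 2%:R /
         ((x + 3%:R) * (x + 2%:R) * (x + 1) / 6%:R) ->
  v <= (x - 4%:R) * ((x + 3%:R) / 4%:R * ((x + 3%:R) / 4%:R + 1) / 2%:R /
         ((x + 3%:R) * (x + 2%:R) * (x + 1) * x / 24%:R)) ->
  (u + v + 6%:R / ((x + 3%:R) * (x + 2%:R) * (x + 1))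
    + 2%:R / ((x + 3%:R) * (x + 2%:R)) + (x + 3%:R)^-1) * (x + 3%:R) <= 5%:R / 2%:R.
Proof.
move=> x14 ule vle.
pose y := x - 14%:R; have y0 : 0 <= y by rewrite subr_ge0.
have xE : x = y + 14%:R by rewrite subrK.
have y2 : 0 <= y ^+ 2 by rewrite exprn_ge0.
have y3 : 0 <= y ^+ 3 by rewrite exprn_ge0.
clearbody y.
have x0 : 0 < x by lra.
have x1 : 0 < x + 1 by lra.
have x2 : 0 < x + 2%:R by lra.
have x3 : 0 < x + 3%:R by lra.
have x21 : 0 < (x + 2%:R) * (x + 1) by rewrite mulr_gt0.
have x210 : 0 < (x + 2%:R) * (x + 1) * x by rewrite mulr_gt0.
have {}ule : u * (x + 3%:R) <= 12%:R / 25%:R.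
  apply: le_trans (ler_wpM2r (ltW x3) ule) _.
  have -> : (x + 3%:R) / 3%:R * ((x + 3%:R) / 3%:R + 1) / 2%:R /
         ((x + 3%:R) * (x + 2%:R) * (x + 1) / 6%:R) * (x + 3%:R)
    = (x + 3%:R) * (x + 6%:R) / 3%:R / ((x + 2%:R) * (x + 1)).
    by field; rewrite ?lt0r_neq0.
  rewrite (ler_pdivrMr _ _ x21) xE; lra.
have {}vle : v * (x + 3%:R) <= 33%:R / 40%:R.
  apply: le_trans (ler_wpM2r (ltW x3) vle) _.
  have -> : (x - 4%:R) * ((x + 3%:R) / 4%:R * ((x + 3%:R) / 4%:R + 1) / 2%:R /
         ((x + 3%:R) * (x + 2%:R) * (x + 1) * x / 24%:R)) * (x + 3%:R)
    = 3%:R / 4%:R * ((x + 3%:R) * (x + 7%:R) * (x - 4%:R)) / ((x + 2%:R) * (x + 1) * x).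
    by field; rewrite ?lt0r_neq0.
  rewrite (ler_pdivrMr _ _ x210) xE; lra.
have e1 : 6%:R / ((x + 3%:R) * (x + 2%:R) * (x + 1)) * (x + 3%:R) <= 1 / 40%:R.
  have -> : 6%:R / ((x + 3%:R) * (x + 2%:R) * (x + 1)) * (x + 3%:R)
    = 6%:R / ((x + 2%:R) * (x + 1)) by field; rewrite ?lt0r_neq0.
  rewrite (ler_pdivrMr _ _ x21) xE; lra.
have e2 : 2%:R / ((x + 3%:R) * (x + 2%:R)) * (x + 3%:R) <= 1 / 8%:R.
  have -> : 2%:R / ((x + 3%:R) * (x + 2%:R)) * (x + 3%:R) = 2%:R / (x + 2%:R).
    by field; rewrite ?lt0r_neq0.
  rewrite (ler_pdivrMr _ _ x2); lra.
have e3 : (x + 3%:R)^-1 * (x + 3%:R) = 1 by rewrite mulVf // lt0r_neq0.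
rewrite !(mulrDl _ _ (x + 3%:R)) e3; move: ule vle e1 e2.
set a := u * _; set b := v * _; set c := 6%:R / _ * _; set d := 2%:R / _ * _.
by clearbody a b c d; lra.
Qed.

(** The summand for [a] is [c (c + 1) / 2] divided by the binomial coefficient,
    where [c] is the integral part of [n / a]; for [4 <= a <= n - 4] it is bounded
    by replacing [a] by 4 everywhere. *)
Lemma orbit_weight_le n : (17 <= n)%N -> orbit_weight n * n%:R <= 5%:R / 2%:R.
Proof.
move=> n17; have [k nk] : exists k, n = k.+3 by exists (n - 3)%N; lia.
pose x : rat := k%:R.
have k14 : (14 <= k)%N by lia.
have x14 : 14%:R <= x by rewrite ler_nat.
have nE : n%:R = x + 3%:R by rewrite -natrD addn3 -nk.
pose t a : rat := \sum_(1 <= b < (n %/ a).+1) b%:R / 'C(n, a)%:R.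
have tE a : t a = (n %/ a)%:R * ((n %/ a)%:R + 1) / 2%:R / 'C(n, a)%:R.
  by rewrite /t -mulr_suml sum_iota_rat.
have t_le a (c C : rat) : (a <= n)%N -> (0 < a)%N -> a%:R * c = n%:R -> 0 < C -> C <= 'C(n, a)%:R ->
    t a <= c * (c + 1) / 2%:R / C.
  move=> an a0 ac C0 CC; rewrite tE.
  have B0 : 0 < 'C(n, a)%:R :> rat by rewrite ltr0n bin_gt0.
  have a0' : 0 < a%:R :> rat by rewrite ltr0n.
  have qc : (n %/ a)%:R <= c.
    by rewrite -(ler_pM2l a0') ac -natrM ler_nat mulnC leq_divM.
  have q0 : 0 <= (n %/ a)%:R :> rat by [].
  have c0 : 0 <= c := le_trans q0 qc.
  apply: ler_pM; [|by rewrite invr_ge0 ltW| |by rewrite lef_pV2].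
    by rewrite divr_ge0 // mulr_ge0 // addr_ge0.
  by rewrite ler_pM2r ?invr_gt0 // ler_pM // ?addr_ge0 // lerD2r.
have t_big a : (n < 2 * a)%N -> (a <= n)%N -> t a = 'C(n, a)%:R^-1.
  move=> na an; have a0 : (0 < a)%N by case: a na {an}.
  have q1 : (n %/ a = 1)%N.
    by rewrite -(subnK an) divnDr // divnn a0 divn_small //; lia.
  have e1 : 1%:R * (1%:R + 1) / 2%:R = 1 :> rat by lra.
  by rewrite tE q1 e1 mul1r.
have -> : orbit_weight n = t 3 + \sum_(4 <= a < k) t a + t k + t k.+1 + t k.+2.
  have -> : orbit_weight n = \sum_(3 <= a < n) t a by [].
  clearbody t; rewrite {1}nk !big_nat_recr; try lia.
  by rewrite big_ltn //; lia.
have xS i : (k + i)%:R = x + i%:R :> rat by rewrite natrD.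
have binE j : 'C(n, j)%:R * (j`!)%:R = (n ^_ j)%:R :> rat.
  by rewrite -natrM bin_ffact.
have C4 : 'C(n, 4)%:R = (x + 3%:R) * (x + 2%:R) * (x + 1) * x / 24%:R.
  have -> : (x + 3%:R) * (x + 2%:R) * (x + 1) * x = (n ^_ 4)%:R.
    by rewrite nk !ffactSS ffactn1 !natrM -(xS 3) -(xS 2) -(xS 1%N) addn3 addn2 addn1 !mulrA.
  by rewrite -binE mulfK.
have C3 : 'C(n, 3)%:R = (x + 3%:R) * (x + 2%:R) * (x + 1) / 6%:R.
  have -> : (x + 3%:R) * (x + 2%:R) * (x + 1) = (n ^_ 3)%:R.
    by rewrite nk !ffactSS ffactn0 muln1 !natrM -(xS 3) -(xS 2) -(xS 1%N) addn3 addn2 addn1 !mulrA.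
  by rewrite -binE mulfK.
have C2 : 'C(n, 2)%:R = (x + 3%:R) * (x + 2%:R) / 2%:R.
  have -> : (x + 3%:R) * (x + 2%:R) = (n ^_ 2)%:R.
    by rewrite nk !ffactSS ffactn0 muln1 !natrM -(xS 3) -(xS 2) addn3 addn2.
  by rewrite -binE mulfK.
have tk2 : t k.+2 = (x + 3%:R)^-1.
  rewrite t_big; try lia. by rewrite nk binSn -nk nE.
have tk1 : t k.+1 = 2%:R / ((x + 3%:R) * (x + 2%:R)).
  rewrite t_big; try lia. rewrite -(bin_sub (n := n)); last by lia.
  have -> : (n - k.+1 = 2)%N by lia.
  by rewrite C2 invf_div.
have tk : t k = 6%:R / ((x + 3%:R) * (x + 2%:R) * (x + 1)).
  rewrite t_big; try lia. rewrite -(bin_sub (n := n)); last by lia.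
  have -> : (n - k = 3)%N by lia.
  by rewrite C3 invf_div.
have t3 : t 3 <= (x + 3%:R) / 3%:R * ((x + 3%:R) / 3%:R + 1) / 2%:R / 'C(n, 3)%:R.
  apply: t_le => //; first by lia.
    by rewrite nE; field.
  by rewrite ltr0n bin_gt0; lia.
pose w := (x + 3%:R) / 4%:R * ((x + 3%:R) / 4%:R + 1) / 2%:R / 'C(n, 4)%:R.
have tmid : \sum_(4 <= a < k) t a <= (x - 4%:R) * w.
  apply: le_trans (_ : \sum_(4 <= a < k) w <= _).
    rewrite big_nat_cond [X in _ <= X]big_nat_cond.
    apply: ler_sum => a /andP[/andP[a4 ak] _].
    have C40 : 0 < 'C(n, 4)%:R :> rat by rewrite ltr0n bin_gt0; lia.
    have c4 : 'C(n, 4)%:R <= 'C(n, a)%:R :> rat.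
      by rewrite ler_nat leq_bin_middle //; lia.
    have a0 : 0 < a%:R :> rat by rewrite ltr0n; lia.
    have an : (a <= n)%N by lia.
    apply: le_trans (t_le a (n%:R / a%:R) _ an _ _ C40 c4) _; first by lia.
      by rewrite mulrC divfK // lt0r_neq0.
    rewrite /w -nE ler_pM2r ?invr_gt0 // ler_pM2r ?invr_gt0 //.
    have le4 : n%:R / a%:R <= n%:R / 4%:R :> rat.
      by rewrite ler_pM2l ?ltr0n ?lef_pV2 ?posrE ?ltr0n ?ler_nat //; lia.
    by rewrite ler_pM ?addr_ge0 ?divr_ge0 // lerD2r.
  rewrite big_const_nat iter_addr_0 -[X in X <= _]mulr_natl natrB //; lia.
rewrite C3 in t3; rewrite /w C4 in tmid.
rewrite nE tk2 tk1 tk.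
by apply: orbit_weight_poly_le x14 t3 tmid.
Qed.

(** The two kinds contribute at most [1/8] and [n/3 * 5/(2n) = 5/6]. *)
Lemma sum_inv_admissible_large n (s : seq nat) : (17 <= n)%N -> uniq s ->
  {in s, forall d, (d %| n`!)%N /\ admissible n d} -> \sum_(d <- s) inv d < 1.
Proof.
move=> n17 us sP; apply: le_lt_trans (sum_inv_admissible_le us sP) _.
have F0 : 0 < (uphalf n)`!%:R :> rat by rewrite ltr0n fact_gt0.
have h1 : (2 * tau_fact n)%:R / (uphalf n)`!%:R <= 1 / 8%:R :> rat.
  rewrite (ler_pdivrMr _ _ F0) mulrAC mul1r ler_pdivlMr // -natrM ler_nat.
  by apply: leq_trans (tau_fact_le n17); lia.
have n0 : 0 < n%:R :> rat by rewrite ltr0n; lia.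
have w0 : 0 <= orbit_weight n.
  by apply: sumr_ge0 => a _; apply: sumr_ge0 => b _; rewrite divr_ge0.
have h2 : orbit_weight n * sigma_fact n <= 5%:R / 6%:R.
  apply: le_trans (ler_wpM2l w0 (sigma_fact_le (ltnW n17))) _.
  have three0 : 0 < 3%:R :> rat by [].
  rewrite mulrA (ler_pdivrMr _ _ three0); apply: le_trans (orbit_weight_le n17) _; lra.
by apply: le_lt_trans (lerD h1 h2) _; lra.
Qed.

(** All products of powers [p ^ j] with [j <= e], for the pairs [(p, e)] of the
    list; binary numbers keep the evaluation for factorials up to [16`!] fast. *)
Fixpoint divisor_list (l : seq (N * nat)) : seq N :=
  if l is (p, e) :: l' then
    flatten [seq [seq N.mul x y | x <- divisor_list l'] | y <-
      traject (N.mul p) 1%num e.+1]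
  else [:: 1%num].

Lemma mem_divisor_list (l : seq (N * nat)) d :
  all (fun pe => prime (N.to_nat pe.1)) l ->
  (d %| \prod_(pe <- l) N.to_nat pe.1 ^ pe.2)%N ->
  d \in map N.to_nat (divisor_list l).
Proof.
elim: l d => [|[p e] l IH] d; first by rewrite big_nil dvdn1 inE.
case/andP=> pp lp; rewrite big_cons => /dvdn_mul_split[|x xp [y yl ->]].
  by rewrite expn_gt0 prime_gt0.
have /(dvdn_pfactor _ _ pp)[j je ->] := xp.
have /mapP[y' y'l ->] := IH _ lp yl.
apply/mapP; exists (N.mul y' (N.pow p (N.of_nat j))); last first.
  rewrite N2Nat.inj_mul N2Nat.inj_pow Nat2N.id mulnC; congr (_ * _)%N.
  elim: (j) => //= i <-. by rewrite expnS.
apply/flattenP; exists [seq N.mul x (N.pow p (N.of_nat j)) | x <- divisor_list l];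
  last by apply/mapP; exists y'.
apply/mapP; exists (N.pow p (N.of_nat j)) => //.
apply/trajectP; exists j; rewrite ?ltnS //.
elim: (j) => [|i IHi] //; rewrite iterS -IHi Nat2N.inj_succ N.pow_succ_r'//.
Qed.

Definition prodN (l : seq (N * nat)) : N :=
  foldr (fun pe => N.mul (N.pow pe.1 (N.of_nat pe.2))) 1%num l.

Definition factN n : N := foldr (fun i => N.mul (N.of_nat i)) 1%num (iota 1 n).

Definition dvdN (a b : N) : bool := N.eqb (N.modulo b a) 0%num.

Definition orbit_table n : seq (N * N) :=
  [seq (N.of_nat 'C(n, a), N.of_nat b) | a <- iota 3 (n - 3), b <- iota 1 (n %/ a)].

(** Here [U] and [tbl] stand for the factorial of [uphalf n] and for
    [orbit_table n], which are passed as arguments so that they are evaluated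
    only once. *)
Definition admissibleN n (U : N) (tbl : seq (N * N)) (d : N) : bool :=
  [&& dvdN 3 d, N.leb U (N.mul 2 d) & (4 < n)%N ==> N.leb (N.of_nat n) d]
  || has (fun cb => dvdN cb.1 (N.mul d cb.2)) tbl.

(** With [F = n`!], the sum of the reciprocals of the listed divisors is below 1
    when the sum of their cofactors is below [F]. *)
Definition sum_inv_check n (l : seq (N * nat)) (flt : pred N) : bool :=
  let F := factN n in let U := factN (uphalf n) in let tbl := orbit_table n in
  [&& N.eqb (prodN l) F, all (fun pe => prime (N.to_nat pe.1)) l
    & N.ltb (foldr N.add 0%num
        [seq N.div F d | d <- divisor_list l & [&& dvdN d F, admissibleN n U tbl d & flt d]]) F].

Lemma prodNE l : N.to_nat (prodN l) = (\prod_(pe <- l) N.to_nat pe.1 ^ pe.2)%N.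
Proof.
elim: l => [|[p e] l IH]; first by rewrite big_nil.
rewrite big_cons -IH /= N2Nat.inj_mul N2Nat.inj_pow Nat2N.id; congr (_ * _)%N.
by elim: (e) => //= i IHi; rewrite expnS -IHi.
Qed.

Lemma factNE n : N.to_nat (factN n) = n`!.
Proof.
rewrite /factN fact_prod /index_iota subSS subn0.
elim: (iota 1 n) => [|i r IH]; first by rewrite big_nil.
by rewrite big_cons -IH /= N2Nat.inj_mul Nat2N.id.
Qed.

Lemma dvdNP a b : (N.to_nat a %| N.to_nat b)%N -> dvdN a b.
Proof.
case/dvdnP => q e; apply/N.eqb_spec.
have -> : b = N.mul (N.of_nat q) a.
  by apply: N2Nat.inj; rewrite N2Nat.inj_mul Nat2N.id.
exact: N.Div0.mod_mul.
Qed.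

Lemma admissibleNP n d : admissible n d ->
  admissibleN n (factN (uphalf n)) (orbit_table n) (N.of_nat d).
Proof.
case=> [[d3 Ud nd]|[a [b [a3 an b0 ban cd]]]]; apply/orP; [left|right].
  apply/and3P; split.
  - by apply: dvdNP; rewrite Nat2N.id.
  - have := factNE (uphalf n); move: Ud; set f := _`!; set g := factN _ => Ud e.
    by apply/N.leb_spec0; lia.
  - by apply/implyP => /nd le; apply/N.leb_spec0; lia.
apply/hasP; exists (N.of_nat 'C(n, a), N.of_nat b).
  apply/allpairsPdep; exists a, b; split=> //.
    by rewrite mem_iota a3 addnC subnK // ltnW // (leq_ltn_trans a3).
  by rewrite mem_iota b0 add1n ltnS leq_divRL // (leq_trans _ a3).
by apply: dvdNP; rewrite N2Nat.inj_mul !Nat2N.id.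
Qed.

Lemma sum_inv_checkP n l flt (s : seq nat) : sum_inv_check n l flt -> uniq s ->
  {in s, forall d, [/\ (d %| n`!)%N, admissible n d & flt (N.of_nat d)]} ->
  \sum_(d <- s) inv d < 1.
Proof.
case/and3P => /N.eqb_spec lF lp /N.ltb_spec0 lt us sP.
move: lt; set L := [seq d <- _ | _] => lt.
have F0 : 0 < (n`!)%:R :> rat by rewrite ltr0n fact_gt0.
have sL : {subset s <= map N.to_nat L}.
  move=> d ds; have [dn ad fd] := sP d ds; apply/mapP.
  exists (N.of_nat d); last by rewrite Nat2N.id.
  rewrite mem_filter fd admissibleNP // andbT; apply/andP; split.
    by rewrite andbT; apply: dvdNP; rewrite Nat2N.id factNE.
  have : d \in map N.to_nat (divisor_list l).
    by apply: mem_divisor_list => //; rewrite -prodNE lF factNE.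
  by case/mapP => x xl ->; rewrite N2Nat.id.
apply: le_lt_trans (ler_sum_sub _ us sL) _; first by move=> d; rewrite invr_ge0.
rewrite big_map (eq_big_seq (fun x => (N.to_nat (N.div (factN n) x))%:R / (n`!)%:R)).
  rewrite -mulr_suml ltr_pdivrMr // mul1r -natr_sum ltr_nat -factNE.
  suff -> : (\sum_(x <- L) N.to_nat (N.div (factN n) x) =
     N.to_nat (foldr N.add 0%num [seq N.div (factN n) d | d <- L]))%N by lia.
  elim: (L) => [|x r IH]; first by rewrite big_nil.
  by rewrite big_cons IH /= N2Nat.inj_add.
move=> x; rewrite mem_filter => /andP[/and3P[/N.eqb_spec xF _ _] _].
have xE := N.Div0.div_mod (factN n) x; rewrite xF N.add_0_r in xE.
have xE' : (n`! = N.to_nat x * N.to_nat (N.div (factN n) x))%N.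
  by rewrite -factNE {1}xE N2Nat.inj_mul.
have q0 : (N.to_nat (N.div (factN n) x))%:R != 0 :> rat.
  by rewrite pnatr_eq0; apply: contraTneq F0 => q0; rewrite xE' q0 muln0 ltxx.
by rewrite xE' natrM invfM mulrCA mulfV ?mulr1.
Qed.

Definition fact_primes n : seq (N * nat) :=
  [seq (N.of_nat p, sumn [seq logn p k | k <- iota 1 n]) | p <- iota 2 n.-1 & prime p].

Lemma sum_inv_check_small :
  all (fun n => sum_inv_check n (fact_primes n) predT)
    [:: 3; 5; 6; 7; 9; 10; 11; 12; 13; 14; 15; 16]%N.
Proof. by vm_compute. Qed.

(** For [n = 4] and [n = 8] the sum over all admissible divisors is at least 1,
    but [n], a power of 2, is admissible and coprime to the odd ones: either [n]
    occurs and all others are even, or [n] does not occur. *)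
Lemma sum_inv_check_pow2 : all (fun n =>
    sum_inv_check n (fact_primes n) (dvdN 2) &&
    sum_inv_check n (fact_primes n) (fun d => ~~ N.eqb d (N.of_nat n)))
  [:: 4; 8]%N.
Proof. by vm_compute. Qed.

Theorem sum_inv_admissible_lt1 n (s : seq nat) : (2 < n)%N -> uniq s ->
  {in s, forall d, (d %| n`!)%N /\ admissible n d} ->
  {in s &, forall d e, d != e -> ~~ coprime d e} ->
  \sum_(d <- s) inv d < 1.
Proof.
move=> n2 us sP sco; have [n17|n17] := leqP 17 n.
  exact: sum_inv_admissible_large n17 us sP.
have [n48|n48] := boolP (n \in [:: 4; 8]%N); last first.
  have /(allP sum_inv_check_small) : n \in [:: 3; 5; 6; 7; 9; 10; 11; 12; 13; 14; 15; 16]%N.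
    by move: n48; rewrite !inE; lia.
  by move/sum_inv_checkP; apply=> // d /sP[].
have /andP[evs others] := allP sum_inv_check_pow2 n n48; have [ns|ns] := boolP (n \in s).
  apply: (sum_inv_checkP evs) => // d ds; have [dn ad] := sP d ds; split=> //.
  apply: dvdNP; rewrite Nat2N.id.
  have en : (2 %| n)%N by move: n48; rewrite !inE => /orP[]/eqP ->.
  have [-> //|dn'] := eqVneq d n.
  have := sco _ _ ds ns dn'; apply: contraR => d2.
  have : coprime d 2 by rewrite coprime_sym prime_coprime.
  by move: n48; rewrite !inE => /orP[]/eqP -> d2';
    [exact: (coprimeXr 2 d2') | exact: (coprimeXr 3 d2')].
apply: (sum_inv_checkP others) => // d ds; have [dn ad] := sP d ds; split=> //.
by apply: contraNN ns => /N.eqb_spec /Nat2N.inj <-.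
Qed.

End AdmissibleSums.

(** * Coset partitions of finite symmetric groups *)

Section FiniteGroups.
Import Order.TTheory GRing.Theory Num.Theory.
Import GroupScope.

Lemma admissible_index (T : finType) (K H : {group {perm T}}) :
  'Alt_T \subset K -> H \subset K -> ~~ ('Alt_T \subset H) ->
  admissible #|T| #|K : H|.
Proof.
move=> AK HK AH.
have [/existsP[x /existsP[y /existsP[z /and4P[xy yz xz xyzH]]]]|no3] :=
  boolP [exists x, exists y, exists z, [&& x != y, y != z, x != z & cyc3 x y z \in H]].
  right; apply: (index_of_alt_full AK HK AH (F := x |: [set y; z])).
    by rewrite !cardsU1 !inE cards1 negb_or xy xz yz.
  apply: (@alt_full_base _ _ _ x); first by rewrite !inE eqxx.
  have xzyH : cyc3 x z y \in H by rewrite -cyc3V groupV.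
  by move=> u v; rewrite !inE => /or3P[]/eqP-> /or3P[]/eqP->; rewrite ?eqxx.
have {}no3 x y z : x != y -> y != z -> x != z -> cyc3 x y z \notin H.
  move=> xy yz xz; apply: contra no3 => xyzH.
  by apply/existsP; exists x; apply/existsP; exists y; apply/existsP; exists z; apply/and4P.
left; split.
- exact: dvd3_index_no3 AK HK AH no3.
- exact: uphalf_fact_le_index_no3 AK HK AH no3.
- exact: deg_le_index_no3 AK HK AH.
Qed.

(** The indices are admissible divisors of [n`!] whose reciprocals add up to 1.
    If they were distinct, then [sum_inv_admissible_lt1] would apply: subgroups of
    coprime indices have product [K], so that any two of their cosets meet. *)
Lemma coset_partition_Alt (T : finType) (K : {group {perm T}}) (I : finType)
    (P : pred I) (H : I -> {group {perm T}}) (x : I -> {perm T}) :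
  'Alt_T \subset K ->
  (forall i, P i -> [/\ H i \subset K, ~~ ('Alt_T \subset H i) & x i \in K]) ->
  (forall g, g \in K -> exists2 i, P i & g \in H i :* x i) ->
  (forall i j, P i -> P j -> i != j -> [disjoint H i :* x i & H j :* x j]) ->
  exists i j, [/\ P i, P j, i != j & #|H i| = #|H j|].
Proof.
move=> AK PH cov dis.
have [/existsP[i /existsP[j /and4P[Pi Pj ij /eqP e]]]|no] :=
  boolP [exists i, exists j, [&& P i, P j, i != j & #|H i| == #|H j|]].
  by exists i, j.
pose s := [seq #|K : H i| | i <- enum P].
have K0 := cardG_gt0 K.
have idx i : P i -> (#|H i| * #|K : H i|)%N = #|K|.
  by case/PH=> HK _ _; apply: Lagrange.
have inj i j : P i -> P j -> #|K : H i| = #|K : H j| -> i = j.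
  move=> Pi Pj e; apply/eqP; apply: contraNT no => ij.
  apply/existsP; exists i; apply/existsP; exists j; apply/and4P; split=> //.
  by rewrite -(eqn_pmul2r (indexg_gt0 K (H i))) idx // e idx.
have n2 : (2 < #|T|)%N.
  have [i Pi _] := cov 1 (group1 K); have [HK AH _] := PH i Pi.
  exact: card_gt2_Alt AH.
have : (\sum_(d <- s) (d%:R : rat)^-1 < 1)%R.
  apply: (sum_inv_admissible_lt1 n2).
  - rewrite map_inj_in_uniq ?enum_uniq // => i j.
    by rewrite !mem_enum; apply: inj.
  - move=> d /mapP[i]; rewrite mem_enum => Pi ->; have [HK AH _] := PH i Pi.
    split; last exact: admissible_index.
    apply: dvdn_trans (dvdn_indexg K (H i)) _.
    by rewrite -card_Sym cardSg ?subsetT.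
  - move=> d e /mapP[i + ->] /mapP[j + ->]; rewrite !mem_enum => Pi Pj.
    apply: contra => co; have [HiK _ xiK] := PH i Pi; have [HjK _ xjK] := PH j Pj.
    have [<-//|ij] := eqVneq i j.
    have eK : H i * H j = K by apply: coprime_index_mulG.
    have : x i * (x j)^-1 \in H i * H j by rewrite eK groupM ?groupV.
    case/mulsgP => u v ui vj uv; have /pred0P/(_ (u^-1 * x i)) /= := dis i j Pi Pj ij.
    rewrite mem_rcoset mulgK groupV ui /= mem_rcoset.
    by rewrite -mulgA uv mulKg vj.
rewrite big_map big_enum /= => lt1.
have sumH : (\sum_(i | P i) #|H i| = #|K|)%N.
  have one g : g \in K -> (\sum_(i | P i) (g \in H i :* x i) = 1)%N.
    move=> gK; have [i Pi gi] := cov g gK.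
    rewrite (bigD1 i) //= gi big1 // => j /andP[Pj ji]; apply/eqP; rewrite eqb0.
    by apply/negP => gj; have /pred0P/(_ g) /= := dis j i Pj Pi ji; rewrite gi gj.
  rewrite -sum1_card -(eq_bigr _ one) exchange_big /=; apply: eq_bigr => i Pi.
  have [HK _ xK] := PH i Pi; rewrite -(card_rcoset (H i) (x i)) -sum1_card.
  rewrite big_mkcond [RHS]big_mkcond; apply: eq_bigr => g _.
  have sub : g \in H i :* x i -> g \in K.
    by move/rcosetP=> [h hH ->]; rewrite groupM // (subsetP HK).
  by case: ifP sub => [_ ->//|_ _]; case: ifP.
move: lt1; rewrite (eq_bigr (fun i => (#|H i|%:R / #|K|%:R)%R)) => [|i Pi].
  by rewrite -mulr_suml -natr_sum sumH divff ?ltxx // pnatr_eq0 -lt0n.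
rewrite -(idx i Pi) natrM invfM mulrA divff ?mul1r //.
by rewrite pnatr_eq0 -lt0n cardG_gt0.
Qed.

(** If the subgroup [H i0] contains the alternating group, it is equal to it.  The
    other cosets then consist of permutations of the other parity, hence belong
    to subgroups of the alternating group, and translating by such a permutation
    [g] yields a partition of the alternating group. *)
Lemma herzog_schonheim_perm (T I : finType)
    (H : I -> {group {perm T}}) (x : I -> {perm T}) :
  (forall i, H i != [set: {perm T}] :> {set {perm T}}) ->
  (forall g, exists i, g \in H i :* x i) ->
  (forall i j, i != j -> [disjoint H i :* x i & H j :* x j]) ->
  exists i j, i != j /\ #|H i| = #|H j|.
Proof.
move=> Hproper cov dis.
have [/existsP[i0 A0]|noA] := boolP [exists i, 'Alt_T \subset H i]; last first.
  have [||i j _ _|i [j [_ _ ij e]]] :=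
    @coset_partition_Alt T [group of 'Sym_T] I predT H x (subsetT _).
  - move=> i _; split; rewrite ?subsetT ?inE //.
    by apply: contra noA => Ai; apply/existsP; exists i.
  - by move=> g _; have [i gi] := cov g; exists i.
  - exact: dis.
  - by exists i, j.
have odd0 s : (s \in H i0) = ~~ odd_perm s.
  apply/idP/idP => [sH|ev]; last by rewrite (subsetP A0) // Alt_even.
  apply/negP => odds; case/eqP: (Hproper i0); apply/setP => g; rewrite [RHS]inE.
  have [oddg|evg] := boolP (odd_perm g); last by rewrite (subsetP A0) // Alt_even.
  by rewrite -(groupMr _ sH) (subsetP A0) // Alt_even odd_permM oddg odds.
have coset0 g : (g \in H i0 :* x i0) = (odd_perm g == odd_perm (x i0)).
  by rewrite mem_rcoset odd0 odd_permM odd_permV; do 2!case: odd_perm.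
have [s sN] : exists s, s \notin H i0.
  have : ~~ ([set: {perm T}] \subset H i0) by rewrite subTset.
  by case/subsetPn => s _ sN; exists s.
pose g := s * x i0.
have oddg : odd_perm g = ~~ odd_perm (x i0).
  by rewrite odd_permM; move: sN; rewrite odd0 negbK => ->.
clearbody g.
have parity i y : i != i0 -> y \in H i :* x i -> odd_perm y = odd_perm g.
  move=> ii0 yi; have /pred0P/(_ y) /= := dis i i0 ii0; rewrite yi coset0 oddg /=.
  by do 2!case: odd_perm.
have HA i : i != i0 -> H i \subset 'Alt_T.
  move=> ii0; apply/subsetP => h hH; rewrite Alt_even.
  have := parity i _ ii0 (rcoset_refl (H i) (x i)).
  have := parity i (h * x i) ii0; rewrite mem_rcoset mulgK hH => /(_ isT).
  by rewrite odd_permM => <-; do 2!case: odd_perm.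
have [/existsP[i /andP[ii0 Ai]]|noA] := boolP [exists i, (i != i0) && ('Alt_T \subset H i)].
  exists i, i0; split=> //; apply/eqP; rewrite eqn_leq.
  rewrite !subset_leq_card //; last exact: subset_trans (HA i ii0) A0.
  by apply: subset_trans Ai; apply/subsetP => h; rewrite odd0 Alt_even.
have [|||i [j [_ _ ij e]]] := @coset_partition_Alt T [group of 'Alt_T] I
    (fun i => i != i0) H (fun i => x i * g^-1) (subxx _).
- move=> i ii0; split; first exact: HA.
    by apply: contra noA => Ai; apply/existsP; exists i; rewrite ii0.
  by rewrite Alt_even odd_permM odd_permV (parity i _ ii0 (rcoset_refl _ _)) addbb.
- move=> k; rewrite Alt_even => evk; have [i ki] := cov (k * g).
  exists i; last by move: ki; rewrite !mem_rcoset invMg invgK mulgA.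
  apply: contraTneq ki => ->; rewrite coset0 odd_permM (negPf evk) oddg /=.
  by case: odd_perm.
- move=> i j ii0 ji0 ij; apply/pred0P => k /=; have /pred0P/(_ (k * g)) /= := dis i j ij.
  by rewrite !mem_rcoset !invMg !invgK !mulgA.
by exists i, j.
Qed.

End FiniteGroups.

From mathcomp Require Import finmap boolp classical_sets functions cardinality.
(* From here on [Sym] is again the group of all permutations of a type, and not
   the group of permutations of a finite type. *)
Require Import Defs.

Local Open Scope group_scope.
Local Open Scope classical_set_scope.

(** * Subgroups of finite index *)

Section FiniteIndex.
Variable G : groupType.
Implicit Types (H : set G) (x g : G).

Definition finite_index H :=
  exists xs : seq G, forall g, exists2 x, x \in xs & right_coset H x g.

Lemma right_cosetE H x g : right_coset H x g <-> H (g * x^-1).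
Proof.
split=> [[h Hh <-]|Hg]; first by rewrite mulgK.
by exists (g * x^-1); rewrite ?mulgVK.
Qed.

Section Subgroup.
Variable H : set G.
Hypothesis subH : is_subgroup H.

Lemma subgroup1 : H 1.
Proof. by have [+ _] := subH; rewrite !inE. Qed.

Lemma subgroupV g : H g -> H g^-1.
Proof. by have /group_closedV/(_ g) := subH; rewrite !inE. Qed.

Lemma subgroupM g h : H g -> H h -> H (g * h).
Proof. by move=> Hg Hh; have /group_closedM/(_ g h) := subH; rewrite !inE; apply. Qed.

End Subgroup.

(** Induction on the number of subgroups involved.  If the cosets of [H i0] alone
    do not cover the group, a coset of [H i0] that is missed is covered by the
    cosets of the other subgroups; its translates cover the given cosets of
    [H i0], which can thus be replaced. *)
Lemma neumann_finite_index k (H : 'I_k -> set G) (s : seq ('I_k * G)) :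
  (forall i, is_subgroup (H i)) ->
  (forall g, exists2 p, p \in s & right_coset (H p.1) p.2 g) ->
  exists i, finite_index (H i).
Proof.
move=> subH; suff main j (r : seq ('I_k * G)) :
    (forall p, p \in r -> p.1 < j) ->
    (forall g, exists2 p, p \in r & right_coset (H p.1) p.2 g) ->
    exists i, finite_index (H i).
  by apply: (main k) => p _.
elim: j r => [|j IH] r rj cov.
  by have [p /rj] := cov 1.
have [jk|kj] := ltnP j k; last first.
  by apply: (IH r) => // p _; apply: leq_trans kj.
pose i0 := Ordinal jk.
have [fin|infin] := pselect (finite_index (H i0)); first by exists i0.
pose xs := [seq p.2 | p <- r & p.1 == i0].
have /existsNP[y yN] : ~ forall g, exists2 x, x \in xs & right_coset (H i0) x g.
  by move=> all; apply: infin; exists xs.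
pose r' := [seq p <- r | p.1 != i0].
apply: (IH (r' ++ [seq (p.1, p.2 * y^-1 * x) | p <- r', x <- xs])).
  have r'j p : p \in r' -> p.1 < j.
    rewrite mem_filter => /andP[pi0 /rj]; rewrite ltnS leq_eqVlt => /orP[|//].
    by move=> pj; case/negP: pi0; apply/eqP/val_inj/eqP.
  move=> p; rewrite mem_cat => /orP[/r'j//|/allpairsP[[q x] /= [qr _ ->]]].
  exact: (r'j q qr).
move=> g; have [p pr pg] := cov g.
have [pi0|pi0] := eqVneq p.1 i0; last first.
  by exists p => //; rewrite mem_cat mem_filter pi0 pr.
move: pg; rewrite pi0 => /right_cosetE Hg.
have [q qr] := cov (g * p.2^-1 * y).
have [qi0|qi0] := eqVneq q.1 i0.
  rewrite qi0 => /right_cosetE Hq; case: yN; exists q.2.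
    by apply: (map_f (fun p => p.2)); rewrite mem_filter qi0 eqxx.
  apply/right_cosetE; have := subgroupM (subH i0) (subgroupV (subH i0) Hg) Hq.
  by rewrite -(mulgA (g * p.2^-1)) mulKg.
move/right_cosetE => Hq.
exists (q.1, q.2 * y^-1 * p.2).
  rewrite mem_cat; apply/orP; right; apply/allpairsP; exists (q, p.2); split=> //=.
    by rewrite mem_filter qi0.
  by apply: (map_f (fun p => p.2)); rewrite mem_filter pi0 eqxx.
by apply/right_cosetE => /=; rewrite !invgM invgK !mulgA in Hq *.
Qed.

(** Among the powers of [g] with exponents up to the number of cosets, two lie in
    the same coset. *)
Lemma finite_index_exponent H : is_subgroup H -> finite_index H ->
  exists2 m, 0 < m & forall g, H (g ^+ m).
Proof.
move=> subH [xs cov]; exists (size xs)`!; first exact: fact_gt0.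
move=> g; have /choice[c cP] : forall j : nat, exists x, x \in xs /\ right_coset H x (g ^+ j).
  by move=> j; have [x] := cov (g ^+ j); exists x.
pose s := [seq c j | j <- iota 0 (size xs).+1].
have : ~~ uniq s.
  apply/negP => us; have /(uniq_leq_size us) : {subset s <= xs}.
    by move=> _ /mapP[j _ ->]; have [] := cP j.
  by rewrite size_map size_iota ltnn.
case/(uniqPn 1) => i [j [ij]]; rewrite size_map size_iota => js.
rewrite !(nth_map 0) ?size_iota ?(ltn_trans ij) // !nth_iota ?(ltn_trans ij) // !add0n => e.
have Hij : H (g ^+ (j - i)).
  have /right_cosetE Hi := (cP i).2; have /right_cosetE := (cP j).2.
  rewrite -e => Hj; have := subgroupM subH Hj (subgroupV subH Hi).
  by rewrite invgM invgK -mulgA mulKg expgnFr // ltnW.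
have pow n : H (g ^+ (j - i) ^+ n).
  by elim: n => [|n IHn]; rewrite ?expg0 ?expgS; [exact: subgroup1|exact: subgroupM].
have /dvdnP[q ->] : (j - i) %| (size xs)`!.
  by rewrite dvdn_fact // subn_gt0 ij leq_subLR (leq_trans _ (leq_addl _ _)).
by rewrite mulnC expgnA.
Qed.

End FiniteIndex.

(** * Infinite symmetric groups *)

Lemma symX (Omega : Type) (s : Sym Omega) n a : (s ^+ n) a = iter n s a.
Proof. by elim: n a => [|n IH] a //; rewrite expgS symM IH iterSr. Qed.

(** Permutations are built below as mere maps, whose bijectivity then comes for
    free from an iterate that is known. *)
Lemma bij_of_iter (T : Type) (f : T -> T) n :
  0 < n -> involutive (iter n f) -> bijective f.
Proof.
case: n => // n _ fK; exists (fun x => iter n f (iter n.+1 f x)) => x.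
  by rewrite -iterSr -[RHS]fK -iterSr iterS -!iterSr -iterS -!iterD addnC.
by rewrite -iterS fK.
Qed.

Definition sym_of_involution (T : Type) (f : T -> T) (fK : involutive f) : Sym T :=
  MkSym (inv_bij fK).

Section Transposition.
Variable T : eqType.
Definition swap (a b x : T) := if x == a then b else if x == b then a else x.
Lemma swapK a b : involutive (swap a b).
Proof.
move=> x; rewrite /swap; have [->|xa] := eqVneq x a.
  by rewrite eqxx; case: eqVneq.
have [->|xb] := eqVneq x b; first by rewrite eqxx.
by rewrite (negPf xa) (negPf xb).
Qed.
Definition transp a b : Sym T := sym_of_involution (swapK a b).
End Transposition.

(** The elements of [nat * bool] form pairs, indexed by [nat].  The pairs from
    [o] on are grouped into blocks of [m] consecutive pairs, and on each block the
    map is a cycle of length [2m] whose [m]-th power flips all pairs. *)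
Definition block_cycle m o (u : nat * bool) :=
  if u.1 < o then u else
  if (u.1 - o) %% m == m.-1 then (u.1 - m.-1, ~~ u.2) else (u.1.+1, u.2).

Definition flip_from o (u : nat * bool) := (u.1, if u.1 < o then u.2 else ~~ u.2).

Lemma iter_block_cycle m o u : 0 < m -> iter m (block_cycle m o) u = flip_from o u.
Proof.
move=> m0; case: u => k i; rewrite /flip_from /=; have [ko|ok] := ltnP k o.
  by rewrite iter_fix // /block_cycle /= ko.
pose q := (k - o) %/ m; pose r := (k - o) %% m.
have rm : r < m by rewrite ltn_mod.
have kE : k = o + (q * m + r) by rewrite -divn_eq subnKC.
have up j s (b : bool) : s + j < m ->
    iter j (block_cycle m o) (o + (q * m + s), b) = (o + (q * m + (s + j)), b).
  elim: j => [|j IH] sj; first by rewrite addn0.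
  rewrite iterS IH; last by lia.
  rewrite /block_cycle /= ltnNge leq_addr /= addKn modnMDl modn_small; last by lia.
  case: eqP => [|_]; first by lia.
  by congr pair; lia.
have mE : m = (r + (m - r.+1).+1) by lia.
rewrite {1}mE iterD iterS {1}kE up; last by lia.
have -> : block_cycle m o (o + (q * m + (r + (m - r.+1))), i) = (o + (q * m + 0), ~~ i).
  rewrite /block_cycle /= ltnNge leq_addr /= addKn modnMDl modn_small; last by lia.
  case: eqP => [_|]; last by lia.
  by congr pair; lia.
by rewrite up; [rewrite add0n -kE|lia].
Qed.

Lemma flip_fromK o : involutive (flip_from o).
Proof. by move=> [k i]; rewrite /flip_from /=; case: ltnP => ko; rewrite ?negbK. Qed.

Section Infinite.
Variables (T : choiceType) (H : set (Sym T)) (m : nat).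
Hypotheses (infT : infinite_set [set: T]) (subH : is_subgroup H).
Hypotheses (m0 : 0 < m) (powH : forall g, H (g ^+ m)).

Lemma involution_power_mem (t : Sym T) (c : T -> T) : involutive t -> iter m c =1 t -> H t.
Proof.
move=> tK ct; have cK : involutive (iter m c) by move=> x; rewrite !ct.
pose s := MkSym (bij_of_iter m0 cK).
by have -> : t = s ^+ m by apply: symP => x; rewrite symX /= ct.
Qed.

Definition extend (i : nat * bool -> T) (p : nat * bool -> nat * bool) x :=
  if pselect (exists u, i u = x) is left e then i (p (projT1 (cid e))) else x.

Lemma extendE i p u : injective i -> extend i p (i u) = i (p u).
Proof.
move=> ii; rewrite /extend; case: pselect => [e|[]]; last by exists u.
by rewrite (ii _ _ (projT2 (cid e))).
Qed.

Lemma extend_out i p x : ~ (exists u, i u = x) -> extend i p x = x.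
Proof. by rewrite /extend; case: pselect. Qed.

(** The pair of [a] and [b] is completed to a sequence of disjoint pairs.  Flipping
    all pairs, and flipping all but the first, are both [m]-th powers, and their
    product is the transposition. *)
Lemma transp_mem a b : a != b -> H (transp a b).
Proof.
move=> ab.
have /infiniteP le : infinite_set ([set: T] `\` [set a; b]).
  by apply: infinite_setD => //; rewrite finite_setU; split; exact: finite_set1.
have [f] := card_leP le.
pose j u : T := \val (f (SigSub (mem_set (I : [set: nat] u)))).
have jj : injective j by move=> u v /val_inj /(inj (mem_set I) (mem_set I)) [].
have jab u : j u != a /\ j u != b.
  have [_ nab] := set_valP (f (SigSub (mem_set (I : [set: nat] u)))).
  by split; apply/eqP => e; apply: nab; [left|right].
pose i (u : nat * bool) := if u.1 is k.+1 then j (k.*2 + u.2) else if u.2 then b else a.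
have ii : injective i.
  move=> [[|k] x] [[|l] y]; rewrite /i /=.
  - by case: x; case: y => // /eqP; rewrite ?(negPf ab) // eq_sym (negPf ab).
  - by case: (jab (l.*2 + y)) => ? ?; case: x => /eqP; rewrite eq_sym; exact: contraTeq.
  - by case: (jab (k.*2 + x)) => ? ?; case: y => /eqP; exact: contraTeq.
  - by move/jj => e; have [-> ->] : k = l /\ x = y by move: e; case: x; case: y => /=; lia.
have flipH o (s : Sym T) : (forall u, s (i u) = i (flip_from o u)) ->
    (forall x, ~ (exists u, i u = x) -> s x = x) -> involutive s -> H s.
  move=> si so sK; apply: (@involution_power_mem s (extend i (block_cycle m o)) sK) => x.
  have [[u <-]|nx] := pselect (exists u, i u = x).
    rewrite si -(iter_block_cycle o u m0).
    by move: (block_cycle m o) => p; elim: (m) => //= n ->; rewrite extendE.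
  by rewrite so // iter_fix // extend_out.
have extK o : involutive (extend i (flip_from o)).
  move=> x; have [[u <-]|nx] := pselect (exists u, i u = x).
    by rewrite !extendE // flip_fromK.
  by rewrite !extend_out.
pose v o := sym_of_involution (extK o).
have vH o : H (v o).
  exact: (flipH o (v o) (fun u => extendE _ u ii) (fun x => @extend_out i _ x) (extK o)).
have -> : transp a b = v 0%N * v 1%N; last exact: subgroupM.
apply: symP => x; rewrite symM /=; have [[u <-]|nx] := pselect (exists u, i u = x).
  rewrite !extendE //; case: u => [[|k] e]; rewrite /flip_from /i /swap /=.
    by case: e; rewrite /= ?eqxx // eq_sym (negPf ab).
  by have [/negPf-> /negPf->] := jab (k.*2 + e); rewrite negbK.
rewrite !extend_out // /swap; case: eqP => [xa|_]; first by case: nx; exists (0%N, false).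
by case: eqP => // xb; case: nx; exists (0%N, true).
Qed.

(** Multiplying [u] by one of its transpositions does not lead into [H], so this can
    be repeated; in particular [u] does not have finite support. *)
Lemma involution_out_pairs n (u : Sym T) : involutive u -> ~ H u ->
  exists2 xs : seq T, size xs = n & uniq (xs ++ map u xs).
Proof.
elim: n u => [|n IH] u uK uN; first by exists [::].
have /existsNP[a ua] : ~ forall a, u a = a.
  move=> u1; apply: uN; suff -> : u = 1 by exact: subgroup1.
  by apply: symP => a; rewrite sym1 u1.
have {}ua : a != u a by apply/eqP => e; apply: ua.
pose w := u * transp a (u a).
have wE x : w x = if (x == a) || (x == u a) then x else u x.
  rewrite symM /= /swap; case: eqVneq => [ux|uxa] /=.
    by rewrite -ux uK eqxx orbT.
  rewrite (can2_eq uK uK) in uxa; rewrite (inj_eq (can_inj uK)) (negPf uxa) orbF.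
  by case: eqP.
have wK : involutive w.
  move=> x; rewrite (wE x); case: ifP => [xa|xN]; rewrite wE ?xa //.
  by rewrite (can2_eq uK uK) (inj_eq (can_inj uK)) orbC xN uK.
have wN : ~ H w.
  move=> Hw; apply: uN; have -> : u = w * transp a (u a).
    suff e : transp a (u a) * transp a (u a) = 1 by rewrite /w -mulgA e mulg1.
    by apply: symP => y; rewrite symM /= swapK.
  exact: subgroupM Hw (transp_mem ua).
have [xs sxs uxs] := IH w wK wN.
have moved x : x \in xs -> w x != x.
  move=> xxs; apply/eqP => wx; move: uxs; rewrite cat_uniq => /and3P[_ /hasPn/(_ x) no _].
  by have /negP[] : x \notin xs by apply: no; rewrite -{1}wx map_f.
have mE : map w xs = map u xs.
  apply/eq_in_map => x /moved; rewrite wE; case: ifP => //; by rewrite eqxx.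
have nax x : x \in xs -> (x == a) || (x == u a) = false.
  by move/moved; rewrite wE; case: ifP => //; rewrite eqxx.
exists (a :: xs); first by rewrite /= sxs.
have aN : a \notin xs by apply/negP => /nax; rewrite eqxx.
have uaN : u a \notin xs by apply/negP => /nax; rewrite eqxx orbT.
have aN' : a \notin map u xs.
  by apply: contra uaN => /mapP[x xxs ->]; rewrite uK.
have uaN' : u a \notin map u xs by rewrite (mem_map (can_inj uK)).
rewrite /= (perm_uniq (permEl (perm_catCA xs [:: u a] _))) /= -mE uxs andbT mE.
by rewrite !mem_cat inE !negb_or aN uaN ua aN' uaN'.
Qed.

(** A map [c] that permutes its support and is an [m]-th root of [t] there. *)
Definition partial_root (t c : T -> T) :=
  forall x, c x <> x -> c (c x) <> c x /\ iter m c x = t x.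

Definition extends (c d : T -> T) := forall x, c x <> x -> d x = c x.

Lemma iter_extends c d x : (forall y, c y <> y -> c (c y) <> c y) ->
  extends c d -> c x <> x -> forall j, iter j d x = iter j c x /\ c (iter j c x) <> iter j c x.
Proof.
move=> cc cd cx; elim=> [//|j [IHd IHc]] /=; rewrite IHd; split; first exact: cd.
exact: cc.
Qed.

(** Zorn's lemma: a chain of partial roots has its union as an upper bound. *)
Lemma ex_maximal_root t : exists2 c, partial_root t c &
  forall d, partial_root t d -> extends c d -> d = c.
Proof.
pose S := {c | partial_root t c}.
pose R (r s : S) := `[< extends (sval r) (sval s) >].
have [|||A Atot|[c cP] cmax] := @Zorn S R.
- by move=> s; apply/asboolP.
- move=> p q r /asboolP pq /asboolP qr; apply/asboolP => x px.
  by rewrite qr pq.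
- move=> [p pP] [q qP] /asboolP/= pq /asboolP/= qp; apply: eq_exist; apply: funext => x.
  have [px|px] := pselect (p x = x); last by rewrite pq.
  by have [qx|qx] := pselect (q x = x); [rewrite px qx|rewrite qp].
- pose U x := if pselect (exists s, A s /\ sval s x <> x) is left e
    then sval (projT1 (cid e)) x else x.
  have UE s x : A s -> sval s x <> x -> U x = sval s x.
    move=> As sx; rewrite /U; case: pselect => [e|[]]; last by exists s.
    have [Ar rx] := projT2 (cid e); set r := projT1 (cid e) in Ar rx *.
    by have [/asboolP->|/asboolP->] := Atot _ _ As Ar.
  have UP : partial_root t U.
    move=> x Ux; have [s As sx] : exists2 s, A s & sval s x <> x.
      move: Ux; rewrite {1}/U; case: pselect => // e _.
      by exists (projT1 (cid e)); have [] := projT2 (cid e).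
    have sU : extends (sval s) U by move=> y; exact: UE.
    have sP := proj2_sig s.
    have it := iter_extends (fun y sy => (sP y sy).1) sU sx.
    split; last by rewrite (it m).1; exact: (sP x sx).2.
    have [e1 n1] := it 1%N; have [e2 _] := it 2%N.
    by rewrite -[U x]/(iter 1 U x) -[U _]/(iter 2 U x) e1 e2.
  exists (exist _ U UP) => s As; apply/asboolP => x sx; exact: UE.
exists c => // d dP cd.
have Rcd : R (exist _ c cP) (exist _ d dP) by apply/asboolP.
by have /(congr1 sval) := cmax _ Rcd.
Qed.

(** Let [c] be a maximal partial root of [t].  Then [t] is the product of the
    [m]-th power of [c] and an involution [u] with a disjoint support.  If [u] were
    not in [H], it would flip [m] disjoint pairs, and a cycle of length [2m]
    through these pairs would extend [c]. *)
Lemma involution_mem (t : Sym T) : involutive t -> H t.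
Proof.
move=> tK; have [c cP cmax] := ex_maximal_root t.
have cc y : c y <> y -> c (c y) <> c y by move=> /cP[].
have ct x : c x <> x -> iter m c x = t x by move=> /cP[].
have moved x : c x <> x -> c (t x) <> t x.
  by move=> cx; rewrite -ct //; have [] := iter_extends cc (fun _ _ => erefl) cx m.
have fixed x : c x = x -> c (t x) = t x.
  by move=> cx; have [//|/moved] := pselect (c (t x) = t x); rewrite tK.
pose w x := if c x == x then x else t x.
pose u x := if c x == x then t x else x.
have wK : involutive w.
  move=> x; rewrite /w; have [cx|/eqP cx] := eqVneq (c x) x; first by rewrite cx eqxx.
  by have /eqP/negPf-> := moved x cx.
have uK : involutive u.
  move=> x; rewrite /u; have [cx|/eqP cx] := eqVneq (c x) x.
    by rewrite fixed // eqxx.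
  by have /eqP/negPf-> := cx.
have -> : t = sym_of_involution wK * sym_of_involution uK.
  apply: symP => x; rewrite symM /= /w /u.
  have [cx|/eqP cx] := eqVneq (c x) x; first by rewrite cx eqxx.
  by have /eqP/negPf-> := moved x cx.
apply: subgroupM => //.
  apply: (@involution_power_mem _ c) => // x /=; rewrite /w.
  by have [cx|/eqP /ct //] := eqVneq (c x) x; rewrite iter_fix.
apply: contrapT => uN.
have [xs sxs uL] := @involution_out_pairs m (sym_of_involution uK) uK uN.
set L := xs ++ map u xs; rewrite -/L in uL.
have sL : size L = m + m by rewrite size_cat size_map sxs.
have uE x : x \in L -> u x = t x /\ c x = x.
  move=> xL; suff : u x != x by rewrite /u; case: (eqVneq (c x) x) => // _; rewrite eqxx.
  have /and3P[_ /hasPn no _] : [&& uniq xs, ~~ has [in xs] (map u xs) & uniq (map u xs)].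
    by rewrite -cat_uniq.
  move: xL; rewrite mem_cat => /orP[xxs|/mapP[y yxs ->]].
    by apply: (contraTneq _ xxs) => <-; apply: no; rewrite map_f.
  by rewrite uK; apply: (contraTneq _ yxs) => ->; apply: no; rewrite map_f.
(* On the list [x_0 .. x_(m-1) u(x_0) .. u(x_(m-1))] the shift by one place has
   the shift by [m] places, that is [u], as its [m]-th power. *)
pose d x := if x \in L then nth x L ((index x L).+1 %% size L) else c x.
have s0 : 0 < size L by rewrite sL addn_gt0 m0.
have iter_d x j : x \in L -> iter j d x = nth x L ((index x L + j) %% size L).
  move=> xL; elim: j => [|j IH].
    by rewrite addn0 modn_small ?index_mem // nth_index.
  rewrite iterS IH; set i := _ %% _.
  have iL : i < size L by rewrite ltn_mod.
  rewrite /d mem_nth // index_uniq // (set_nth_default x) ?ltn_mod //.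
  by rewrite addnS -addn1 modnDml addn1.
have d_mem x : x \in L -> d x \in L by move=> xL; rewrite /d xL mem_nth // ltn_mod.
have d_moved x : x \in L -> d x <> x.
  move=> xL /eqP; rewrite /d xL -{3}(nth_index x xL) nth_uniq ?ltn_mod ?index_mem //.
  have := xL; rewrite -index_mem; move: (index x L) => i iL.
  have [iS|Li] := ltnP i.+1 (size L); first by rewrite modn_small // eqn_leq ltnn.
  have eL : size L = i.+1 by apply/eqP; rewrite eqn_leq Li iL.
  by rewrite -eL modnn eq_sym => /eqP i0; move: eL; rewrite i0 sL; move: m0; clear; lia.
have cd : extends c d.
  by move=> x cx; rewrite /d; case: ifP => // xL; case: (uE x xL) => _ /cx.
have dP : partial_root t d.
  move=> x; have [xL _|xL] := boolP (x \in L).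
    split; first by apply: d_moved; apply: d_mem.
    rewrite -(uE x xL).1 iter_d // sL.
    move: (xL); rewrite {1}/L mem_cat; have [xxs _|xNxs /= /mapP[y yxs xy]] := boolP (x \in xs).
      have ix : index x xs < m by rewrite -sxs index_mem.
      rewrite /L index_cat xxs modn_small ?ltn_add2r // nth_cat sxs ltnNge leq_addl /=.
      by rewrite addnK (nth_map x) ?sxs // nth_index.
    have iy : index y xs < m by rewrite -sxs index_mem.
    have iu : index x (map u xs) = index y xs by rewrite xy (index_map (can_inj uK)).
    rewrite /L index_cat (negPf xNxs) iu sxs.
    rewrite addnAC modnDl modn_small; last by rewrite ltn_addr.
    by rewrite nth_cat sxs iy nth_index // xy uK.
  rewrite {1}/d (negPf xL) => cx.
  have [itd _] := iter_extends cc cd cx m; rewrite itd ct //; split=> //.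
  by rewrite (cd x cx) (cd (c x) (cc x cx)); exact: cc.
have [x xL] : exists x, x \in L by case: (L) s0 => [//|x l _]; exists x; rewrite mem_head.
by apply: (d_moved x xL); rewrite (cmax d dP cd); case: (uE x xL).
Qed.

End Infinite.

(** Each orbit of [g], a finite or infinite cycle, is reflected at a chosen
    point [r]: the image of the [k]-th iterate of [r] is its [-k]-th iterate.
    Integral exponents are avoided by writing all relations with two natural
    numbers. *)
Section TwoInvolutions.
Variables (T : choiceType) (g : Sym T).

Let gI n : injective (iter n g).
Proof. by elim: n => [|n IH] x y //= /(can_inj (sym_invK g)); apply: IH. Qed.

Definition in_orbit x y := `[< exists i j, iter i g x = iter j g y >].

Lemma in_orbit_refl x : in_orbit x x.
Proof. by apply/asboolP; exists 0%N, 0%N. Qed.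

Lemma in_orbit_sym x y : in_orbit x y -> in_orbit y x.
Proof. by move=> /asboolP[i [j e]]; apply/asboolP; exists j, i. Qed.

Lemma in_orbit_trans x y z : in_orbit x y -> in_orbit y z -> in_orbit x z.
Proof.
move=> /asboolP[i [j xy]] /asboolP[k [l yz]]; apply/asboolP; exists (k + i), (j + l).
by rewrite !iterD xy -yz -!iterD addnC.
Qed.

Definition orbit_repr x := xchoose (ex_intro (in_orbit x) x (in_orbit_refl x)).

Lemma orbit_reprP x : in_orbit x (orbit_repr x).
Proof. exact: xchooseP. Qed.

Lemma orbit_repr_eq x y : in_orbit x y -> orbit_repr x = orbit_repr y.
Proof.
move=> xy; apply: eq_xchoose => z; apply/idP/idP; apply: in_orbit_trans => //.
exact: in_orbit_sym.
Qed.

Definition reflects x y :=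
  exists i j, iter i g x = iter j g (orbit_repr x) /\ iter j g y = iter i g (orbit_repr x).

Lemma ex_reflects x : exists y, reflects x y.
Proof.
have /asboolP[i [j e]] := orbit_reprP x.
exists (iter j (sym_inv g) (iter i g (orbit_repr x))), i, j; split=> //.
elim: (j) (iter i g _) => // n IH z.
by rewrite iterS -[RHS]IH -iterS iterSr [iter n.+1 (sym_inv g) z]iterS sym_invKV.
Qed.

Lemma reflects_inj x y z : reflects x y -> reflects x z -> y = z.
Proof.
set r := orbit_repr x => -[i [j [xr yr]]] [k [l [xr' zr]]].
apply: (@gI (l + j)); rewrite iterD yr [in RHS]addnC iterD zr -!iterD.
have : iter (k + j) g r = iter (i + l) g r.
  by rewrite iterD -xr -iterD addnC iterD xr' -iterD.
by rewrite !(addnC l) !(addnC j) => ->.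
Qed.

Definition reflection x := projT1 (cid (ex_reflects x)).

Lemma reflectionP x : reflects x (reflection x).
Proof. exact: projT2 (cid (ex_reflects x)). Qed.

Lemma reflectionE x y : reflects x y -> reflection x = y.
Proof. exact: reflects_inj (reflectionP x). Qed.

Lemma reflectionK : involutive reflection.
Proof.
move=> x; apply: reflectionE; have [i [j [xr yr]]] := reflectionP x.
rewrite /reflects; have <- : orbit_repr x = orbit_repr (reflection x).
  apply: orbit_repr_eq; apply/asboolP; exists (i + i), (j + j).
  by rewrite !iterD xr yr -!iterD addnC.
by exists j, i.
Qed.

Lemma reflection_step x : g (reflection (g x)) = reflection x.
Proof.
have [i [j [xr yr]]] := reflectionP x.
suff -> : reflection (g x) = sym_inv g (reflection x) by rewrite sym_invKV.
apply: reflectionE; exists i, j.+1.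
have <- : orbit_repr x = orbit_repr (g x).
  by apply: orbit_repr_eq; apply/asboolP; exists 1%N, 0%N.
by split; [rewrite -iterSr iterS xr | rewrite iterSr sym_invKV].
Qed.

Lemma sym_two_involutions :
  exists a b : Sym T, [/\ involutive a, involutive b & g = a * b].
Proof.
pose a := sym_of_involution reflectionK; exists a, (a * g); split.
- exact: reflectionK.
- by move=> x; rewrite !symM /= reflection_step reflectionK.
- by apply: symP => x; rewrite !symM /= reflectionK.
Qed.

End TwoInvolutions.

(** Finite index provides an exponent [m] with all [m]-th powers in [H], and these
    generate all involutions. *)
Theorem finite_index_Sym_infinite (T : choiceType) (H : set (Sym T)) :
  infinite_set [set: T] -> is_subgroup H -> finite_index H -> H = [set: Sym T].
Proof.
move=> infT subH /(finite_index_exponent subH)[m m0 powH].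
apply/seteqP; split=> // g _.
have [a [b [aK bK ->]]] := sym_two_involutions g.
by apply: subgroupM => //; apply: (involution_mem infT subH m0 powH).
Qed.

(** * Transfer to permutations of a finite type, and the theorem *)

(** A bijection [f] with a finite type identifies the two notions of a permutation,
    and of the index of a subgroup. *)
Section FiniteTransfer.
Variables (T : choiceType) (F : finType) (f : T -> F) (g : F -> T).
Hypotheses (fK : cancel f g) (gK : cancel g f).

Lemma sym_of_perm_subproof (p : {perm F}) : bijective (fun x => g (p (f x))).
Proof.
exists (fun x => g (p^-1 (f x))) => x; first by rewrite gK permK fK.
by rewrite gK permKV fK.
Qed.

Definition sym_of_perm p : Sym T := MkSym (sym_of_perm_subproof p).

Lemma perm_of_sym_subproof (s : Sym T) : injective (fun u => f (s (g u))).
Proof. exact: inj_comp (can_inj fK) (inj_comp (bij_inj (sym_bij s)) (can_inj gK)). Qed.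

Definition perm_of_sym s : {perm F} := perm (@perm_of_sym_subproof s).

Lemma perm_of_symK : cancel perm_of_sym sym_of_perm.
Proof. by move=> s; apply: symP => x /=; rewrite permE !fK. Qed.

Lemma sym_of_permK : cancel sym_of_perm perm_of_sym.
Proof. by move=> p; apply/permP => u; rewrite permE /= !gK. Qed.

Lemma sym_of_permM : {morph sym_of_perm : p q / p * q}.
Proof. by move=> p q; apply: symP => x; rewrite symM /= permM gK. Qed.

Lemma sym_of_perm1 : sym_of_perm 1 = 1.
Proof. by apply: symP => x /=; rewrite perm1 fK. Qed.

Lemma sym_of_permV p : sym_of_perm p^-1 = (sym_of_perm p)^-1.
Proof. by apply: (mulgI (sym_of_perm p)); rewrite -sym_of_permM !mulgV sym_of_perm1. Qed.

Section Subgroup.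
Variable H : set (Sym T).
Hypothesis subH : is_subgroup H.

Definition perm_set : {set {perm F}} := finset (fun p => `[< H (sym_of_perm p) >]).

Lemma perm_setP p : reflect (H (sym_of_perm p)) (p \in perm_set).
Proof. by rewrite finset.inE; apply: asboolP. Qed.

Lemma perm_set_group_set : group_set perm_set.
Proof.
apply/group_setP; split; first by apply/perm_setP; rewrite sym_of_perm1; exact: subgroup1.
move=> p q /perm_setP Hp /perm_setP Hq; apply/perm_setP.
by rewrite sym_of_permM; exact: subgroupM.
Qed.

Definition perm_group : {group {perm F}} := Group perm_set_group_set.

Lemma mem_perm_rcoset p y :
  (p \in perm_group :* perm_of_sym y) = `[< right_coset H y (sym_of_perm p) >].
Proof.
rewrite mem_rcoset; apply/perm_setP/asboolP; rewrite right_cosetE;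
by rewrite sym_of_permM sym_of_permV perm_of_symK.
Qed.

Lemma right_cosets_card : (right_cosets H #= `I_#|rcosets perm_group [set: {perm F}]%SET|)%card.
Proof.
pose X := rcosets perm_group [set: {perm F}]%SET.
pose Phi (A : {set {perm F}}) : set (Sym T) := [set s | perm_of_sym s \in A].
have PhiI : injective Phi.
  move=> A B AB; apply/setP => p; have := congr1 (fun C : set _ => C (sym_of_perm p)) AB.
  by rewrite /Phi /= sym_of_permK => e; apply/idP/idP; rewrite e.
have -> : right_cosets H = (fun k => Phi (nth finset.set0 (enum X) k)) @` `I_#|X|.
  apply/seteqP; split=> [_ [y _ <-]|_ [k /= kX <-]].
    have yX : (perm_group :* perm_of_sym y)%g \in enum X.
      by rewrite mem_enum; apply/rcosetsP; exists (perm_of_sym y); rewrite ?finset.inE.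
    exists (index (perm_group :* perm_of_sym y)%g (enum X)).
      by rewrite /= cardE index_mem.
    rewrite nth_index //; apply/seteqP.
    by split=> s; rewrite /Phi /= mem_perm_rcoset perm_of_symK => /asboolP.
  have : nth finset.set0 (enum X) k \in enum X by rewrite mem_nth // -cardE.
  rewrite mem_enum => /rcosetsP[p _ ->]; exists (sym_of_perm p) => //.
  have pE s : (perm_of_sym s \in perm_group :* p) = `[< right_coset H (sym_of_perm p) s >].
    by rewrite -[s in RHS]perm_of_symK -mem_perm_rcoset sym_of_permK.
  by apply/seteqP; split=> s; rewrite /Phi /= pE => /asboolP.
apply: inj_card_eq => i j; rewrite !inE /= => iX jX /PhiI/eqP.
by rewrite nth_uniq ?enum_uniq -?cardE // => /eqP.
Qed.

End Subgroup.
End FiniteTransfer.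

Lemma herzog_schonheim_Sym (T : choiceType) (k : nat)
    (H : 'I_k -> set (Sym T)) (x : 'I_k -> Sym T) :
  (forall i, is_subgroup (H i)) -> (forall i, H i <> [set: Sym T]) ->
  [set: Sym T] = \bigcup_(i in [set: 'I_k]) right_coset (H i) (x i) ->
  (forall i j, i <> j ->
     right_coset (H i) (x i) `&` right_coset (H j) (x j) = set0) ->
  exists i j, i <> j /\ eq_index (H i) (H j).
Proof.
move=> subH Hproper cov dis.
have covP s : exists i, right_coset (H i) (x i) s.
  by have : [set: Sym T] s by []; rewrite cov => -[i _ ?]; exists i.
have [|infT] := pselect (finite_set [set: T]); last first.
  have [||i fin] := @neumann_finite_index _ k H [seq (i, x i) | i <- enum 'I_k].
  - exact: subH.
  - move=> s; have [i si] := covP s; exists (i, x i) => //.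
    by apply: map_f; rewrite mem_enum.
  by case: (Hproper i); exact: finite_index_Sym_infinite.
case/finite_fsetP=> X XT.
have XP y : y \in X by have : [set: T] y by []; rewrite XT.
pose f y : X := [` XP y]%fset; pose g (u : X) : T := val u.
have fK : cancel f g by [].
have gK : cancel g f by move=> u; apply: val_inj.
have [|p|i j ij|i [j [/eqP ij e]]] := @herzog_schonheim_perm X 'I_k
    (fun i => perm_group fK gK (subH i)) (fun i => perm_of_sym fK gK (x i)).
- move=> i; apply/eqP => HT; apply: (Hproper i); apply/seteqP; split=> // s _.
  rewrite -(perm_of_symK fK gK s); apply/(perm_setP fK gK).
  by rewrite [perm_set _ _ _]HT finset.inE.
- have [i pi] := covP (sym_of_perm fK gK p); exists i.
  by rewrite mem_perm_rcoset; apply/asboolP.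
- apply: contraT => /pred0Pn[p /= /andP[]].
  rewrite (mem_perm_rcoset fK gK (subH i)) (mem_perm_rcoset fK gK (subH j)).
  move=> /asboolP pi /asboolP pj.
  suff : set0 (sym_of_perm fK gK p) by [].
  by rewrite -(dis i j) //; apply/eqP.
exists i, j; split=> //; rewrite /eq_index.
have := right_cosets_card fK gK (subH i); have := right_cosets_card fK gK (subH j).
have indexE l : #|rcosets (perm_group fK gK (subH l)) [set: {perm X}]%SET| =
    #|[set: {perm X}]%SET| %/ #|perm_group fK gK (subH l)|.
  exact/esym/(divgS (G := [set: {perm X}]%G) (finset.subsetT _)).
rewrite !indexE e => Hj; rewrite card_eq_sym => Hi.
by rewrite card_eq_sym; apply: card_eq_trans Hj _.
Qed.

Unset Implicit Arguments.

Theorem theorem1p2 (Omega : Type) (k : nat)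
    (H : 'I_k -> set (Sym Omega)) (x : 'I_k -> Sym Omega)
    (k_ge2 : (2 <= k)%N)
    (H_subgroup : forall i, is_subgroup (H i))
    (H_proper : forall i, H i <> [set: Sym Omega])
    (H_cover : [set: Sym Omega] = \bigcup_(i in [set: 'I_k]) right_coset (H i) (x i))
    (H_disjoint : forall i j, i <> j ->
       right_coset (H i) (x i) `&` right_coset (H j) (x j) = set0) :
  exists i j, i <> j /\ eq_index (H i) (H j).
Proof.
clear k_ge2; move: H x H_subgroup H_proper H_cover H_disjoint.
elim/Pchoice: Omega => Omega H x.
exact: herzog_schonheim_Sym.
Qed.
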